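(* Let $\alpha$ be a non-zero algebraic number. Then there exists $\beta\in K_\alpha$ such that $M_\infty(\alpha)=M(\beta)$. In particular, $M_\infty(\alpha)\in K_\alpha$.
   Context: Fix an embedding $\overline{\mathbb{Q}}\subseteq\mathbb{C}$, so that $K_\alpha$, the Galois closure of $\mathbb{Q}(\alpha)$ over $\mathbb{Q}$, is a subfield of $\mathbb{C}$ and the real number $M_\infty(\alpha)$ may be compared with it. For a number field $F$ and a place $v$ of $F$ over the place $p$ of $\mathbb{Q}$, let $\|\cdot\|_v$ extend the usual absolute value of $\mathbb{Q}_p$ to $F_v$ and set $|x|_v=\|x\|_v^{[F_v:\mathbb{Q}_p]/[F:\mathbb{Q}]}$. The Weil height is $H(x)=\prod_v\max\{1,|x|_v\}$ over all places of $F$ (independent of $F$), and the Mahler measure is $M(x)=H(x)^{[\mathbb{Q}(x):\mathbb{Q}]}$. The ultrametric Mahler measure is $M_\infty(\alpha)=\inf\{\max_{1\le n\le N}M(\alpha_n): N\in\mathbb{N},\ \alpha_n\in\overline{\mathbb{Q}}^\times,\ \alpha=\prod_{n=1}^N\alpha_n\}$. *)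

(* Defs.v *)
From HB Require Import structures.
From mathcomp Require Import all_boot all_order all_algebra all_field.
From mathcomp Require Import all_classical all_reals all_analysis.
From mathcomp.real_closed Require Import complex.

Set Implicit Arguments.
Unset Strict Implicit.
Unset Printing Implicit Defensive.

Import Order.TTheory GRing.Theory Num.Theory.

Local Open Scope classical_set_scope.
Local Open Scope ring_scope.

Definition absolute_value (R : realType) (F : fieldType) (v : F -> R) : Prop :=
  [/\ forall x, 0 <= v x,
      forall x, v x = 0 <-> x = 0,
      forall x y, v (x * y) = v x * v y &
      forall x y, v (x + y) <= v x + v y].

Variant rat_place := RatInfinite | RatFinite p of prime p.

(* The usual absolute values on Q: |q| = max(q, -q), and |q|_p = p^(- ord_p q) *)
(* with ord_p q = logn p (numerator) - logn p (denominator).                   *)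
Definition rat_abs (R : realType) (w : rat_place) (q : rat) : R :=
  match w with
  | RatInfinite => `|ratr q|
  | RatFinite p _ =>
      if q == 0 then 0
      else (p%:R : R) ^ ((logn p `|denq q|%N)%:Z - (logn p `|numq q|%N)%:Z)
  end.

(* A place v of the number field F over the place w of Q is represented by its *)
(* normalized absolute value ||.||_v, the unique member of the equivalence     *)
(* class v that extends the usual absolute value attached to w.                *)
Definition place_over (R : realType) (F : fieldExtType rat) (w : rat_place) :
    set (F -> R) :=
  [set v | absolute_value v /\ forall q : rat, v q%:A = rat_abs R w q].

Definition places (R : realType) (F : fieldExtType rat) : set (F -> R) :=
  [set v | exists w : rat_place, place_over w v].

(* The completion F_v is the ring of Cauchy sequences of (F, v) modulo the     *)
(* null sequences; the copy of Q_p in F_v consists of the classes of the       *)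
(* Cauchy sequences of rational numbers.                                       *)
Section Completion.
Variables (R : realType) (F : fieldExtType rat) (v : F -> R).

Definition cauchy_seq (u : nat -> F) : Prop :=
  forall e : R, 0 < e ->
  exists N : nat, forall m n : nat, (N <= m)%N -> (N <= n)%N -> v (u m - u n) < e.

Definition null_seq (u : nat -> F) : Prop :=
  forall e : R, 0 < e ->
  exists N : nat, forall n : nat, (N <= n)%N -> v (u n) < e.

Definition rat_cauchy_seq (c : nat -> rat) : Prop :=
  cauchy_seq (fun k => (c k)%:A).

(* The classes of b_0, ..., b_(n-1) form a basis of F_v over Q_p. *)
Definition completion_basis (n : nat) (b : 'I_n -> nat -> F) : Prop :=
  [/\ forall i, cauchy_seq (b i),
      forall x, cauchy_seq x ->
        exists c : 'I_n -> nat -> rat,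
          (forall i, rat_cauchy_seq (c i)) /\
          null_seq (fun k => x k - \sum_(i < n) c i k *: b i k) &
      forall c : 'I_n -> nat -> rat,
        (forall i, rat_cauchy_seq (c i)) ->
        null_seq (fun k => \sum_(i < n) c i k *: b i k) ->
        forall i, null_seq (fun k => (c i k)%:A)].

(* [F_v : Q_p]; the default value 0 is never used when v is a place of F. *)
Definition local_degree : nat :=
  xget 0%N [set n | exists b : 'I_n -> nat -> F, completion_basis b].

Definition place_norm (x : F) : R :=
  v x `^ (local_degree%:R / (\dim {: F})%:R).

End Completion.

(* All but finitely many factors are 1, so that the finitely supported product *)
(* is the product over all places.                                             *)
Definition field_height (R : realType) (F : fieldExtType rat) (x : F) : R :=
  \big[*%R/1]_(v \in @places R F) Num.max 1 (place_norm v x).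

(* num_field_exists [:: x] is a number field Q(x) together with an embedding   *)
(* QsC into algC and a sequence s1 which generates Q(x) over Q and satisfies   *)
(* map QsC s1 = [:: x]; the head of s1 is thus x as an element of Q(x).        *)
Definition Qadj (x : algC) : fieldExtType rat := tag (num_field_exists [:: x]).

Definition Qadj_gen (x : algC) : Qadj x :=
  head 0 (s2val (tagged (tagged (num_field_exists [:: x])))).

(* As the height does not depend on the number field containing x, it is       *)
(* computed in Q(x).                                                           *)
Definition weil_height (R : realType) (x : algC) : R :=
  field_height R (Qadj_gen x).

Definition mahler (R : realType) (x : algC) : R :=
  weil_height R x ^+ \dim {: Qadj x}.

(* The maximum over the nonempty index set 'I_N.+1 is computed from the value  *)
(* at ord0 as starting point.                                                  *)
Definition ultrametric_mahler (R : realType) (alpha : algC) : R :=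
  inf [set m : R | exists (N : nat) (a : 'I_N.+1 -> algC),
    [/\ forall n, a n != 0,
        alpha = \prod_(n < N.+1) a n &
        m = \big[Num.max/mahler R (a ord0)]_(n < N.+1) mahler R (a n)]].

Definition normal_subfield (K : {pred algC}) : Prop :=
  divring_closed K /\
  forall y z : algC, y \in K -> root (minCpoly y) z -> z \in K.

(* The smallest subfield of algC that contains alpha and is normal, hence      *)
(* Galois, over Q.                                                             *)
Definition galois_closure (alpha : algC) : set algC :=
  [set x | forall K : {pred algC}, normal_subfield K -> alpha \in K -> x \in K].

(* Main.v *)
Require Import Defs.
From HB Require Import structures.
From mathcomp Require Import all_boot all_order all_algebra all_fingroup all_field.
From mathcomp Require Import all_classical all_reals all_analysis.
From mathcomp.real_closed Require Import complex.
From mathcomp Require Import ring lra zify.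

Import Order.TTheory GRing.Theory Num.Theory.

Set Implicit Arguments.
Unset Strict Implicit.
Unset Printing Implicit Defensive.

Local Open Scope ring_scope.

(** For a prime p, a maximal subring of the algebraic numbers that does not
    contain 1/p is a valuation ring, so |.|_p extends to an absolute value A_p
    of the algebraic numbers; at the infinite place one composes iota with the
    complex modulus. Weak approximation shows that the places of Q(x) over w
    are the A_w \o s, s running over the embeddings of Q(x), and that the local
    degree of such a place is the number of embeddings that induce it. Hence
    M(x) is the product over w and over the conjugates r of x of max(1, A_w r),
    which by Gauss's lemma is the Mahler measure of the primitive integral
    minimal polynomial of x.

    Let alpha be the product of the a_n, let L be a normal number field
    containing all of them, H = Gal(L / K_alpha), and let b_n, in K_alpha, be the
    product of the d_n distinct H-conjugates of a_n. Counting stabilizers in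
    Gal(L / Q) gives M(b_n) <= M(a_n). Moreover alpha is a root of unity times a
    product of d_n-th roots of the b_n, and M(y) <= M(y^d), so the maximum of the
    M(b_n) is again bounded below by M_oo(alpha). By Northcott's theorem the
    values of M on K_alpha are locally finite, so the infimum is attained at one
    of the b_n. Finally M(b) is, up to sign, the product of the leading
    coefficient and of the conjugates of b of modulus > 1, all in K_alpha. *)

(** The infimum ranges over factors of unbounded degree, so finiteness of small values does not
    apply to it directly. Replacing each factor by its norm down to K_alpha bounds the degrees, but
    the norms no longer multiply to alpha. The competing values are therefore taken from
    [radical_value]: families in K_alpha having roots that multiply to alpha up to a root of unity.
    Each value of one kind dominates a value of the other kind, so the two infima agree, and the
    values of the second kind are locally finite. No completion is built. Limits are taken inside
    the algebraic numbers, for one extension A_w of each rational absolute value, and the closure of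
    the rationals there stands in for the completed rational field. Every place over w comes from
    the same A_w by composition with an embedding. Inequalities between Mahler measures are proved
    one absolute value at a time: a p-adic one compares the exponents of p in two leading
    coefficients, the archimedean one compares products over conjugates. *)

(** * Conjugates of an algebraic number *)

Definition conjs (x : algC) : seq algC :=
  sval (closed_field_poly_normal (minCpoly x)).

Lemma minCpolyE x : minCpoly x = \prod_(r <- conjs x) ('X - r%:P).
Proof.
rewrite /conjs; case: closed_field_poly_normal => s /= Ds; rewrite {1}Ds.
by rewrite (monicP (minCpoly_monic x)) scale1r.
Qed.

Lemma mem_conjs x r : (r \in conjs x) = root (minCpoly x) r.
Proof. by rewrite minCpolyE root_prod_XsubC. Qed.

Lemma conjs_refl x : x \in conjs x.
Proof. by rewrite mem_conjs root_minCpoly. Qed.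

Lemma size_conjs x : size (minCpoly x) = (size (conjs x)).+1.
Proof. by rewrite minCpolyE size_prod_XsubC. Qed.

Lemma minCpoly_dvd x (q : {poly rat}) :
  root (map_poly ratr q) x -> minCpoly x %| map_poly ratr q.
Proof.
by have [p [-> _] dv] := minCpolyP x; rewrite dv dvdp_map.
Qed.

Lemma minCpoly_rat x : exists p : {poly rat}, minCpoly x = map_poly ratr p.
Proof. by have [p [-> _] _] := minCpolyP x; exists p. Qed.

(** The minimal polynomial q of r divides that of x, say p = s q, and x is a root of s or of q. A
    root of s is impossible because deg s < deg p, so p divides q as well. *)
Lemma minCpoly_conjs x r : r \in conjs x -> minCpoly r = minCpoly x.
Proof.
rewrite mem_conjs.
have [p [Dp mon_p] dv] := minCpolyP x; have [q [Dq mon_q] dvq] := minCpolyP r.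
rewrite Dp dvq => /dvdpP [s Ds]; rewrite Dq; suff -> : q = p by [].
have : root (map_poly ratr p) x by rewrite dv.
rewrite {1}Ds rmorphM rootM !dv => /orP[]; last first.
  move=> pq; apply/eqP; rewrite -eqp_monic //.
  by rewrite /eqp pq Ds dvdp_mull.
move=> /dvdp_leq ps.
have q1 : (1 < size q)%N by have := size_minCpoly r; rewrite Dq size_map_poly.
have s0 : s != 0.
  by apply: contraTneq mon_p => s0; rewrite Ds s0 mul0r monicE lead_coef0 eq_sym oner_eq0.
have := ps s0; rewrite {1}Ds size_mul // ?monic_neq0 //.
by rewrite -subn1 leq_subLR addnC leq_add2r leqNgt q1.
Qed.

Lemma conjs_aut (nu : {rmorphism algC -> algC}) x : nu x \in conjs x.
Proof. by rewrite mem_conjs -(minCpoly_aut nu) root_minCpoly. Qed.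

(** Bridge between Galois theory, which is available in an abstract number field, and conjugates
    inside [algC]. *)
Lemma map_minPoly_minCpoly (L : fieldExtType rat) (LC : {rmorphism L -> algC}) (y : L) :
  map_poly LC (minPoly 1 y) = minCpoly (LC y).
Proof.
have rat_of (q : {poly L}) : q \is a polyOver 1%VS ->
    exists q1 : {poly rat}, map_poly LC q = map_poly ratr q1 /\ q = map_poly (in_alg L) q1.
  move=> q1.
  have aP i : q`_i \in 1%VS by apply/polyOverP.
  have a_ i := sig_eqW (vlineP _ _ (aP i)).
  exists (\poly_(i < size q) sval (a_ i)).
  have e : q = map_poly (in_alg L) (\poly_(i < size q) sval (a_ i)).
    apply/polyP => i; rewrite coef_map coef_poly /=.
    case: ltnP => [_|szi]; first by case: (a_ i).
    by rewrite nth_default ?scale0r.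
  split=> //; rewrite {1}e -map_poly_comp; apply: eq_map_poly => b /=.
  by rewrite alg_num_field fmorph_rat.
have [p [Dp mon_p] dv] := minCpolyP (LC y).
have [q [Dq Dq1]] := rat_of _ (minPolyOver 1 y).
apply/eqP; rewrite -eqp_monic ?minCpoly_monic //; last first.
  by rewrite map_monic monic_minPoly.
apply/andP; split; last first.
  by rewrite Dq; apply: minCpoly_dvd; rewrite -Dq fmorph_root root_minPoly.
have -> : minCpoly (LC y) = map_poly LC (map_poly (in_alg L) p).
  rewrite Dp -map_poly_comp; apply: eq_map_poly => b /=.
  by rewrite alg_num_field fmorph_rat.
rewrite dvdp_map minPoly_dvdp //.
  by apply/polyOverP => i; rewrite coef_map /= memvZ ?mem1v.
rewrite -(fmorph_root LC) -map_poly_comp.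
have -> : map_poly (LC \o in_alg L) p = minCpoly (LC y).
  by rewrite Dp; apply: eq_map_poly => b /=; rewrite alg_num_field fmorph_rat.
exact: root_minCpoly.
Qed.

Lemma num_field_separable (L : fieldExtType rat) (y : L) :
  separable_element 1 y.
Proof.
by apply: pcharf0_separable => p; rewrite pchar_lalg pchar_num.
Qed.

Lemma conjs_uniq x : uniq (conjs x).
Proof.
have [L [LC [[|y []] // [<- _]]]] := num_field_exists [:: x].
rewrite -separable_prod_XsubC -minCpolyE -map_minPoly_minCpoly separable_map.
exact: num_field_separable.
Qed.

(** Adjoining all conjugates of all members of [s] gives a splitting field of the product of their
    minimal polynomials, and characteristic 0 makes it Galois. *)
Lemma normal_num_field_exists (s : seq algC) :
  exists (L : splittingFieldType rat) (LC : {rmorphism L -> algC}) (s1 : seq L),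
    galois 1 {:L} /\ {subset s <= map LC s1}.
Proof.
pose t := flatten (map conjs s).
have [L0 [LC [s1 Ds1 gen]]] := num_field_exists t.
pose p := \prod_(x <- s) minCpoly x.
have [q Dq] : exists q : {poly rat}, map_poly ratr q = p.
  rewrite /p; elim: (s) => [|x u [q IH]]; first by exists 1; rewrite big_nil rmorph1.
  have [q1 Dq1] := minCpoly_rat x; exists (q1 * q).
  by rewrite big_cons rmorphM /= IH Dq1.
have Dp : p = \prod_(r <- t) ('X - r%:P).
  rewrite /p /t; elim: (s) => [|x u IH]; first by rewrite !big_nil.
  by rewrite big_cons /= big_cat IH -minCpolyE.
pose q1 := map_poly (in_alg L0) q.
have q1over : q1 \is a polyOver 1%AS.
  by apply/polyOverP => i; rewrite coef_map /= memvZ ?mem1v.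
have Dq1 : q1 = \prod_(y <- s1) ('X - y%:P).
  apply: (map_poly_inj LC); rewrite -map_poly_comp.
  have -> : map_poly (LC \o in_alg L0) q = p.
    by rewrite -Dq; apply: eq_map_poly => b /=; rewrite alg_num_field fmorph_rat.
  rewrite Dp -Ds1 big_map rmorph_prod /=; apply: eq_bigr => y _.
  by rewrite map_polyXsubC.
have split1 : splittingFieldFor 1 q1 {:L0} by exists s1; rewrite ?Dq1 ?eqpxx.
have L_ax : FieldExt_isSplittingField _ L0 by constructor; exists q1.
pose L : splittingFieldType rat := HB.pack_for (splittingFieldType rat) L0 L_ax.
exists L, LC, s1; split=> //.
- apply/and3P; split; [exact: subvf | | exact: normalFieldf].
  by apply/separableP => y _; exact: num_field_separable.
- move=> x xs; rewrite Ds1; apply/flatten_mapP; exists x => //; exact: conjs_refl.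
Qed.

(** The Galois group of a normal number field containing x and r is transitive on the roots of an
    irreducible polynomial, and its elements extend to [algC]. *)
Lemma conjs_autP x r : r \in conjs x ->
  exists nu : {rmorphism algC -> algC}, nu x = r.
Proof.
move=> xr; have [L [LC [s1 [galL sub]]]] := normal_num_field_exists [:: x; r].
have /mapP[y _ Dy] : x \in map LC s1 by rewrite sub ?mem_head.
have /mapP[z _ Dz] : r \in map LC s1 by rewrite sub ?inE ?eqxx ?orbT.
have rz : root (minPoly 1 y) z.
  by rewrite -(fmorph_root LC) (map_minPoly_minCpoly LC) -Dy -Dz -mem_conjs.
have [g _ gy] := normalField_root_minPoly (subvf _) (normalFieldf 1) (memvf y) rz.
have [nu Dnu] := extend_algC_subfield_aut LC g.
by exists nu; rewrite Dy Dz -Dnu; congr (LC _).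
Qed.

Lemma Crat_aut_fixed (a : algC) :
  (forall nu : {rmorphism algC -> algC}, nu a = a) -> a \in Crat.
Proof.
move=> fix_a; have eq_a r : r \in conjs a -> r = a.
  by move=> /conjs_autP[nu <-].
have : conjs a = [:: a].
  have := conjs_uniq a; have := conjs_refl a.
  case: (conjs a) eq_a => [//|b [|c s]] eq_a; rewrite ?inE; first by move/eqP->.
  move=> _ /= /andP[]; rewrite inE (eq_a b) ?mem_head //.
  by rewrite (eq_a c) ?eqxx // !inE eqxx orbT.
move=> Da; have := minCpolyE a; rewrite Da big_seq1.
have [p ->] := minCpoly_rat a => /(congr1 (fun q : {poly algC} => - q`_0)).
rewrite coefB coefX coefC /= sub0r opprK coef_map /= => <-.
by rewrite rpredN Crat_rat.
Qed.

(** * Absolute values and convergence of sequences *)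

Section AbsoluteValue.
Variables (R : realType) (F : fieldType) (v : F -> R).
Hypothesis absv : absolute_value v.

Lemma absv_ge0 x : 0 <= v x. Proof. by case: absv. Qed.
Lemma absv_eq0 x : (v x == 0) = (x == 0).
Proof. by case: absv => _ h _ _; apply/eqP/eqP => /h. Qed.
Lemma absvM x y : v (x * y) = v x * v y. Proof. by case: absv. Qed.
Lemma absvD x y : v (x + y) <= v x + v y. Proof. by case: absv. Qed.
Lemma absv0 : v 0 = 0. Proof. by apply/eqP; rewrite absv_eq0. Qed.
Lemma absv_gt0 x : (0 < v x) = (x != 0).
Proof. by rewrite lt_def absv_eq0 absv_ge0 andbT. Qed.
Lemma absv1 : v 1 = 1.
Proof.
have /mulIf : v 1 != 0 by rewrite absv_eq0 oner_eq0.
by apply; rewrite mul1r -absvM mulr1.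
Qed.
Lemma absvX x n : v (x ^+ n) = v x ^+ n.
Proof. by elim: n => [|n IH]; rewrite ?expr0 ?absv1 // !exprS absvM IH. Qed.
Lemma absvV x : v x^-1 = (v x)^-1.
Proof.
have [->|x0] := eqVneq x 0; first by rewrite !(invr0, absv0).
have /mulIf : v x != 0 by rewrite absv_eq0.
by apply; rewrite -absvM mulVf // absv1 mulVf // absv_eq0.
Qed.
Lemma absvN x : v (- x) = v x.
Proof.
apply/eqP; rewrite -(@eqrXn2 _ 2) ?absv_ge0 // -!absvX sqrrN //.
Qed.
Lemma absvB x y : v (x - y) <= v x + v y.
Proof. by rewrite -(absvN y) absvD. Qed.
Lemma absvBC x y : v (x - y) = v (y - x).
Proof. by rewrite -absvN opprB. Qed.
Lemma absv_sum (I : Type) (r : seq I) (P : pred I) (G : I -> F) :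
  v (\sum_(i <- r | P i) G i) <= \sum_(i <- r | P i) v (G i).
Proof.
elim/big_ind2: _ => [|x1 x2 y1 y2 h1 h2|//]; first by rewrite absv0.
by rewrite (le_trans (absvD _ _)) // lerD.
Qed.
Lemma absv_prod (I : Type) (r : seq I) (P : pred I) (G : I -> F) :
  v (\prod_(i <- r | P i) G i) = \prod_(i <- r | P i) v (G i).
Proof. exact: (big_morph v absvM absv1). Qed.

(** Convertible with [null_seq] on a number field, but stated for any field because limits are also
    taken in [algC]. *)
Definition vnull (u : nat -> F) : Prop :=
  forall e : R, 0 < e -> exists N : nat, forall n : nat, (N <= n)%N -> v (u n) < e.

Definition vbounded (u : nat -> F) : Prop :=
  exists C N, forall n : nat, (N <= n)%N -> v (u n) <= C.

Definition vconv (u : nat -> F) (a : F) : Prop := vnull (fun n => u n - a).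

Lemma vnull_ext u w : u =1 w -> vnull u -> vnull w.
Proof. by move=> uw uN e /uN[N h]; exists N => n /h; rewrite uw. Qed.

Lemma vconv_ext u w a : u =1 w -> vconv u a -> vconv w a.
Proof. by move=> uw; apply: vnull_ext => n; rewrite uw. Qed.

Lemma vnull_conv u : vnull u <-> vconv u 0.
Proof. by split; apply: vnull_ext => n; rewrite subr0. Qed.

Lemma vnullD u w : vnull u -> vnull w -> vnull (fun n => u n + w n).
Proof.
move=> uN wN e e0; have e2 : 0 < e / 2 by lra.
have [N1 h1] := uN _ e2; have [N2 h2] := wN _ e2.
exists (maxn N1 N2) => n; rewrite geq_max => /andP[/h1 {}h1 /h2 {}h2].
by have := absvD (u n) (w n); lra.
Qed.

Lemma vnullN u : vnull u -> vnull (fun n => - u n).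
Proof. by move=> uN e /uN[N h]; exists N => n /h; rewrite absvN. Qed.

Lemma vnullB u w : vnull u -> vnull w -> vnull (fun n => u n - w n).
Proof. by move=> uN /vnullN; apply: vnullD. Qed.

Lemma vnull0 : vnull (fun=> 0).
Proof. by move=> e e0; exists 0%N => n _; rewrite absv0. Qed.

Lemma vnullMb u w : vbounded w -> vnull u -> vnull (fun n => w n * u n).
Proof.
move=> [C [N1 bw]] uN e e0.
have C0 : 0 < `|C| + 1 by rewrite ltr_wpDl.
have [N2 h2] := uN _ (divr_gt0 e0 C0).
exists (maxn N1 N2) => n; rewrite geq_max => /andP[/bw {}bw /h2].
rewrite absvM ltr_pdivlMr // mulrC => h; apply: le_lt_trans h.
by rewrite ler_wpM2r ?absv_ge0 // (le_trans bw) // (le_trans (ler_norm C)) // lerDl.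
Qed.

Lemma vbounded_cst a : vbounded (fun=> a).
Proof. by exists (v a), 0%N => n _. Qed.

Lemma vboundedD u w : vbounded u -> vbounded w -> vbounded (fun n => u n + w n).
Proof.
move=> [C [N1 bu]] [D [N2 bw]]; exists (C + D), (maxn N1 N2) => n.
by rewrite geq_max => /andP[/bu ? /bw ?]; rewrite (le_trans (absvD _ _)) // lerD.
Qed.

Lemma vnull_bounded u : vnull u -> vbounded u.
Proof. by move=> /(_ 1 ltr01)[N h]; exists 1, N => n /h /ltW. Qed.

Lemma vconv_bounded u a : vconv u a -> vbounded u.
Proof.
move=> /vnull_bounded /vboundedD /(_ (vbounded_cst a)) [C [N h]].
by exists C, N => n /h; rewrite subrK.
Qed.

Lemma vconv_cst a : vconv (fun=> a) a.
Proof. by apply: vnull_ext vnull0 => n; rewrite subrr. Qed.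

Lemma vconvD u w a b : vconv u a -> vconv w b -> vconv (fun n => u n + w n) (a + b).
Proof. by move=> ua wb; apply: vnull_ext (vnullD ua wb) => n; rewrite addrACA opprD. Qed.

Lemma vconvN u a : vconv u a -> vconv (fun n => - u n) (- a).
Proof. by move=> ua; apply: vnull_ext (vnullN ua) => n; rewrite opprB opprK addrC. Qed.

Lemma vconvB u w a b : vconv u a -> vconv w b -> vconv (fun n => u n - w n) (a - b).
Proof. by move=> ua /vconvN; apply: vconvD. Qed.

Lemma vconvM u w a b : vconv u a -> vconv w b -> vconv (fun n => u n * w n) (a * b).
Proof.
move=> ua wb; have := vnullD (vnullMb (vconv_bounded ua) wb) (vnullMb (vbounded_cst b) ua).
by apply: vnull_ext => n; ring.
Qed.

Lemma vconvV u a : a != 0 -> vconv u a -> vconv (fun n => (u n)^-1) a^-1.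
Proof.
move=> a0 ua.
have va : 0 < v a / 2 by rewrite divr_gt0 // absv_gt0.
have [N h] := ua _ va.
have lb n : (N <= n)%N -> v a / 2 <= v (u n).
  move=> /h; rewrite absvBC => {}h.
  by have := absvD (a - u n) (u n); rewrite subrK; lra.
have bV : vbounded (fun n => - (u n)^-1 * a^-1).
  exists ((v a / 2)^-1 * (v a)^-1), N => n /lb {}lb.
  rewrite absvM absvN !absvV ler_wpM2r ?invr_ge0 ?absv_ge0 //.
  by rewrite lef_pV2 // posrE (lt_le_trans va).
have := vnullMb bV ua => nV e /nV[N2 h2]; exists (maxn N N2) => n.
rewrite geq_max => /andP[/lb {}lb /h2]; congr (v _ < e).
have un0 : u n != 0 by rewrite -absv_gt0 (lt_le_trans va).
by field; rewrite un0 a0.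
Qed.

Lemma vconv_sum (I : Type) (r : seq I) (P : pred I) (u : I -> nat -> F) (a : I -> F) :
  (forall i, P i -> vconv (u i) (a i)) ->
  vconv (fun n => \sum_(i <- r | P i) u i n) (\sum_(i <- r | P i) a i).
Proof.
move=> ua; elim: r => [|i r IH].
  by rewrite big_nil; apply: vconv_ext (vconv_cst 0) => n; rewrite big_nil.
rewrite big_cons; case: ifP => Pi; last by apply: vconv_ext IH => n; rewrite big_cons Pi.
by apply: vconv_ext (vconvD (ua i Pi) IH) => n; rewrite big_cons Pi.
Qed.

Lemma vconvX u a k : vconv u a -> vconv (fun n => u n ^+ k) (a ^+ k).
Proof.
move=> ua; elim: k => [|k IH]; first by apply: vconv_ext (vconv_cst _).
by rewrite exprS; apply: vconv_ext (vconvM ua IH) => n; rewrite exprS.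
Qed.

Lemma vconv_unique u a b : vconv u a -> vconv u b -> a = b.
Proof.
move=> ua ub; apply/eqP; rewrite -subr_eq0; apply/negPn/negP.
rewrite -absv_gt0 => /(vnullB ub ua)[N /(_ N (leqnn N))].
by rewrite opprB addrC addrA subrK ltxx.
Qed.

Lemma vnull_geometric z : v z < 1 -> vnull (fun n => z ^+ n).
Proof.
move=> z1 e e0.
have : `|v z| < 1 by rewrite ger0_norm ?absv_ge0.
move=> /cvg_expr /cvgrPdist_lt /(_ e e0) [N _ h].
exists N => n /h /=; rewrite sub0r normrN absvX ger0_norm //.
by rewrite exprn_ge0 ?absv_ge0.
Qed.

Lemma vconv_horner (p : nat -> {poly F}) (q : {poly F}) u a d :
  (forall n, size (p n) <= d)%N -> (size q <= d)%N ->
  (forall i, vconv (fun n => (p n)`_i) q`_i) -> vconv u a ->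
  vconv (fun n => (p n).[u n]) q.[a].
Proof.
move=> szp szq pq ua; rewrite (horner_coef_wide _ szq).
have := @vconv_sum _ (index_enum 'I_d) xpredT (fun i n => (p n)`_i * u n ^+ i) _
  (fun i _ => vconvM (pq i) (vconvX i ua)).
by apply: vconv_ext => n; rewrite (horner_coef_wide _ (szp n)).
Qed.

Lemma vconv_prod_XsubC (I : eqType) (r : seq I) (u : I -> nat -> F) (a : I -> F) :
  (forall i, i \in r -> vconv (u i) (a i)) ->
  forall j, vconv (fun n => (\prod_(i <- r) ('X - (u i n)%:P))`_j)
                  (\prod_(i <- r) ('X - (a i)%:P))`_j.
Proof.
elim: r => [|i r IH] ua j.
  by rewrite big_nil; apply: vconv_ext (vconv_cst _) => n; rewrite big_nil.
rewrite big_cons mulrBl coefB coefXM coefCM.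
have -> : (fun n => (\prod_(i <- i :: r) ('X - (u i n)%:P))`_j) =
   (fun n => (if j == 0%N then 0 else (\prod_(i <- r) ('X - (u i n)%:P))`_j.-1) -
             u i n * (\prod_(i <- r) ('X - (u i n)%:P))`_j).
  by apply/funext => n; rewrite big_cons mulrBl coefB coefXM coefCM.
have {}IH := IH (fun j js => ua j (@mem_behead _ (i :: r) j js)).
apply: vconvB; last exact: vconvM (ua i (mem_head _ _)) (IH j).
by case: j => [|j] /=; [exact: vconv_cst | exact: IH].
Qed.

Lemma vconv_prod (I : Type) (r : seq I) (u : I -> nat -> F) (a : I -> F) :
  (forall i, vconv (u i) (a i)) ->
  vconv (fun n => \prod_(i <- r) u i n) (\prod_(i <- r) a i).
Proof.
move=> ua; elim: r => [|i r IH].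
  by rewrite big_nil; apply: vconv_ext (vconv_cst _) => n; rewrite big_nil.
by rewrite big_cons; apply: vconv_ext (vconvM (ua i) IH) => n; rewrite big_cons.
Qed.

Lemma vconv_det m (M : nat -> 'M[F]_m) (M0 : 'M[F]_m) :
  (forall i j, vconv (fun n => M n i j) (M0 i j)) ->
  vconv (fun n => \det (M n)) (\det M0).
Proof.
move=> MM0; apply: (@vconv_sum _ _ _
  (fun (s : {perm 'I_m}) n => (-1) ^+ s * \prod_i M n i (s i))) => s _.
by apply: vconvM; [exact: vconv_cst | exact: vconv_prod].
Qed.

Lemma vconv_eventually_lt1 u a : vconv u a -> v a < 1 ->
  exists N, forall n, (N <= n)%N -> v (u n) < 1.
Proof.
move=> ua a1; have [|N h] := ua (1 - v a); first by rewrite subr_gt0.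
exists N => n /h {}h; have := absvD (u n - a) a; rewrite subrK; lra.
Qed.

Lemma vconv_eventually_gt1 u a : vconv u a -> 1 < v a ->
  exists N, forall n, (N <= n)%N -> 1 < v (u n).
Proof.
move=> ua a1; have [|N h] := ua (v a - 1); first by rewrite subr_gt0.
exists N => n /h {}h; have := absvD (a - u n) (u n); rewrite subrK absvBC; lra.
Qed.

End AbsoluteValue.

Lemma absv_comp (R : realType) (F E : fieldType) (v : E -> R) (f : {rmorphism F -> E}) :
  absolute_value v -> absolute_value (v \o f).
Proof.
move=> absv; split=> [x|x|x y|x y] /=.
- exact: absv_ge0.
- split=> [/eqP|->]; last by rewrite rmorph0 absv0.
  by rewrite absv_eq0 // fmorph_eq0 => /eqP.
- by rewrite rmorphM absvM.
- by rewrite rmorphD absvD.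
Qed.

Lemma eventually_all (I : eqType) (s : seq I) (P : I -> nat -> Prop) :
  (forall i, i \in s -> exists N, forall n, (N <= n)%N -> P i n) ->
  exists N, forall n, (N <= n)%N -> forall i, i \in s -> P i n.
Proof.
elim: s => [|i s IH] h; first by exists 0%N.
have [|N1 h1] := IH; first by move=> j js; apply: h; rewrite inE js orbT.
have [N2 h2] := h i (mem_head _ _).
exists (maxn N1 N2) => n; rewrite geq_max => /andP[n1 n2] j.
by rewrite inE => /predU1P[->|js]; [apply: h2 | apply: h1].
Qed.

(** * Weak approximation *)

(** Once (a / b)^s < t, the interval from a^s to b^s is longer, on the logarithmic scale, than one
    step of the powers of t, so it contains such a power. *)
Lemma powers_between (R : realType) (t a b : R) :
  0 < t < 1 -> 0 < a -> a < b ->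
  exists (s : nat) (r : int), a ^+ s < t ^ r <= b ^+ s.
Proof.
move=> /andP[t0 t1] a0 ab.
have b0 := lt_trans a0 ab.
have [s hs] : exists s, (a / b) ^+ s < t.
  have ab1 : `|a / b| < 1.
    by rewrite ger0_norm ?divr_ge0 ?ltW // ltr_pdivrMr // mul1r.
  move/cvg_expr/cvgrPdist_lt: ab1 => /(_ t t0)[N _ /(_ N)] /=.
  rewrite leqnn sub0r normrN ger0_norm; first by move=> /(_ isT); exists N.
  by rewrite exprn_ge0 // divr_ge0 // ltW.
have expE (x : R) n : 0 < x -> x ^+ n = expR (n%:R * ln x).
  by move=> x0; rewrite -powR_mulrn ?ltW // /powR gt_eqF.
have lnt : ln t < 0 by rewrite ln_lt0 // t0 t1.
(* y is the real exponent with t^y = b^s. Rounding it up lowers t^y, by a factor greater than t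
   since t < 1. *)
set y := s%:R * ln b / ln t.
exists s, (Num.ceil y).
have -> : t ^ Num.ceil y = expR ((Num.ceil y)%:~R * ln t).
  by rewrite -powR_intmul ?ltW // /powR gt_eqF.
have Dy : y * ln t = s%:R * ln b by rewrite /y divfK // lt_eqF.
rewrite !expE // ltr_expR ler_expR -Dy.
have := ceil_ge y; have := ceilB1_lt y; rewrite intrD mulrN1z => y1 y2.
rewrite ler_nM2r // y2 andbT.
move: hs; rewrite expE ?divr_gt0 // lnM ?posrE ?invr_gt0 // lnV ?posrE //.
rewrite -{1}[t]lnK ?posrE // ltr_expR mulrDr mulrN => hs.
have : ((Num.ceil y)%:~R - y - 1) * ln t > 0 by rewrite nmulr_lgt0 //; lra.
rewrite !mulrBl Dy mul1r; lra.
Qed.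

(** The common value at c normalizes both absolute values, so being different already makes them
    inequivalent: from v y < u y, a power of y divided by a power of c puts 1 between the two
    values. *)
Lemma absv_separate (R : realType) (F : fieldType) (v u : F -> R) (c : F) :
  absolute_value v -> absolute_value u -> v c = u c -> 0 < v c < 1 -> v <> u ->
  exists z, v z < 1 /\ 1 <= u z.
Proof.
move=> absv absu vuc c01 vu; have /andP[c0 c1] := c01.
have [y vuy] : exists y, v y != u y.
  by apply: contra_notP vu => /forallNP h; apply/funext => y; apply/eqP/negPn/negP/h.
have y0 : y != 0 by apply: contraNneq vuy => ->; rewrite !absv0.
wlog lt : y vuy y0 / v y < u y.
  move=> IH; have := vuy; rewrite neq_lt => /orP[lt|gt]; first exact: (IH y).
  apply: (IH y^-1); rewrite ?invr_eq0 // ?absvV // ?(inj_eq invr_inj) //.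
  by rewrite ltf_pV2 // posrE absv_gt0.
have vy : 0 < v y by rewrite absv_gt0.
have [s [r /andP[h1 h2]]] := powers_between c01 vy lt.
have absXz w : absolute_value w -> forall z n, w (z ^ n) = w z ^ n.
  by move=> absw z [n|n]; rewrite /exprz ?absvV // absvX.
exists (y ^+ s / c ^ r).
rewrite (absvM absv) (absvM absu) (absvV absv) (absvV absu) (absvX absv) (absvX absu).
rewrite (absXz _ _ _ absv) (absXz _ _ _ absu) -vuc.
have cr : 0 < v c ^ r by rewrite exprz_gt0.
by rewrite ltr_pdivrMr // mul1r ler_pdivlMr // mul1r.
Qed.

Section WeakApproximation.
Variables (R : realType) (F : fieldType) (v : F -> R) (c : F).
Variables (I : eqType) (u : I -> F -> R).
Hypotheses (absv : absolute_value v) (absu : forall i, absolute_value (u i)).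
Hypotheses (c01 : 0 < v c < 1) (uc : forall i, u i c = v c).

(** Separation in both directions gives a, small for v, and b, small for [u i]; the quotient b / a
    is strict on both sides. *)
Lemma weak_approximation_pair i : v <> u i -> exists z, 1 < v z /\ u i z < 1.
Proof.
move=> vu.
have [a [va ua]] := absv_separate absv (absu i) (esym (uc i)) c01 vu.
have [|b [ub vb]] := absv_separate (absu i) absv (uc i) _ (nesym vu).
  by rewrite uc.
have a0 : a != 0 by rewrite -(absv_gt0 (absu i)) (lt_le_trans _ ua).
exists (b / a); rewrite (absvM absv) (absvM (absu i)) (absvV absv) (absvV (absu i)); split.
  rewrite ltr_pdivlMr ?absv_gt0 // mul1r; exact: lt_le_trans vb.
rewrite ltr_pdivrMr ?absv_gt0 // mul1r; exact: lt_le_trans ua.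
Qed.

Lemma vconv_ratio (w : F -> R) z : absolute_value w -> 1 < w z ->
  vconv w (fun n => z ^+ n / (1 + z ^+ n)) 1.
Proof.
move=> absw z1; have z0 : z != 0 by rewrite -(absv_gt0 absw) (lt_trans ltr01).
have zV : w z^-1 < 1 by rewrite absvV // invf_lt1 // (lt_trans ltr01).
have := vconvD absw (vconv_cst absw 1) (iffLR (vnull_conv _ _) (vnull_geometric absw zV)).
rewrite addr0 => /(vconvV absw (oner_neq0 _)); rewrite invr1.
apply: vconv_ext => n; rewrite exprVn.
have zn0 : z ^+ n != 0 by rewrite expf_neq0.
rewrite -{1}(divff zn0) -[X in _ + X]mul1r -mulrDl invfM invrK mulrC.
by rewrite (addrC _ 1).
Qed.

Lemma vnull_ratio (w : F -> R) z : absolute_value w -> w z < 1 ->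
  vnull w (fun n => z ^+ n / (1 + z ^+ n)).
Proof.
move=> absw z1; have zn := vnull_geometric absw z1; apply/vnull_conv.
have := vconvD absw (vconv_cst absw 1) (iffLR (vnull_conv _ _) zn).
rewrite addr0 => /(vconvV absw (oner_neq0 _)); rewrite invr1 => h.
by have := vconvM absw (iffLR (vnull_conv _ _) zn) h; rewrite mul0r.
Qed.

(** Artin-Whaples induction: z handles [s] and y handles the new index i. If [u i z <= 1] then z^N y
    works for large N. Otherwise z^N would spoil [u i], and z^N / (1 + z^N) is used, which tends to
    1 where z is large and to 0 where it is small. *)
Lemma weak_approximation_sep (s : seq I) : (forall i, i \in s -> v <> u i) ->
  exists z, 1 < v z /\ forall i, i \in s -> u i z < 1.
Proof.
elim: s => [|i s IH] h.
  have /andP[c0 c1] := c01; exists c^-1; split=> //.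
  by rewrite absvV // invf_gt1.
have [|z [vz uz]] := IH; first by move=> j js; apply: h; rewrite inE js orbT.
have [y [vy uy]] := weak_approximation_pair (h i (mem_head _ _)).
have [le1|gt1] := leP (u i z) 1.
  have [|N hN] := @eventually_all _ s (fun j n => u j (z ^+ n * y) < 1).
    move=> j /uz uz1; have zn := vnull_geometric (absu j) uz1.
    have := vconvM (absu j) (iffLR (vnull_conv _ _) zn) (vconv_cst (absu j) y).
    by rewrite mul0r => /(vconv_eventually_lt1 (absu j)); apply; rewrite absv0.
  exists (z ^+ N * y); split.
    rewrite absvM // absvX //.
    rewrite (lt_le_trans vy) // ler_peMl ?absv_ge0 // exprn_ege1 // ltW //.
  move=> j; rewrite inE => /predU1P[->|js]; last exact: hN.
  rewrite absvM // absvX // (le_lt_trans _ uy) // ler_piMl ?absv_ge0 //.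
  by rewrite exprn_ile1 ?absv_ge0.
pose w n := z ^+ n / (1 + z ^+ n) * y.
have [|N1 h1] := @eventually_all _ s (fun j n => u j (w n) < 1).
  move=> j /uz uz1; have zn := vnull_ratio (absu j) uz1.
  have := vconvM (absu j) (iffLR (vnull_conv _ _) zn) (vconv_cst (absu j) y).
  by rewrite mul0r => /(vconv_eventually_lt1 (absu j)); apply; rewrite absv0.
have := vconvM absv (vconv_ratio absv vz) (vconv_cst absv y).
rewrite mul1r => /(vconv_eventually_gt1 absv)/(_ vy)[N2 h2].
have := vconvM (absu i) (vconv_ratio (absu i) gt1) (vconv_cst (absu i) y).
rewrite mul1r => /(vconv_eventually_lt1 (absu i))/(_ uy)[N3 h3].
pose N := maxn N1 (maxn N2 N3); exists (w N); split.
  by apply: h2; rewrite /N !leq_max leqnn orbT.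
move=> j; rewrite inE => /predU1P[->|js]; last by apply: h1; rewrite ?leq_maxl.
by apply: h3; rewrite /N !leq_max leqnn !orbT.
Qed.

Lemma weak_approximation (s : seq I) : (forall i, i \in s -> v <> u i) ->
  exists z : nat -> F, vconv v z 1 /\ forall i, i \in s -> vnull (u i) z.
Proof.
move=> /weak_approximation_sep[z [vz uz]].
exists (fun n => z ^+ n / (1 + z ^+ n)); split; first exact: vconv_ratio.
by move=> i /uz; apply: vnull_ratio.
Qed.

End WeakApproximation.

(** * Uniqueness of the local degree *)

Section LocalDegreeUnique.
Variables (R : realType) (F : fieldExtType rat) (v : F -> R).
Hypothesis absv : absolute_value v.

Lemma cauchy_bounded u : cauchy_seq v u -> vbounded v u.
Proof.
move=> /(_ 1 ltr01)[N h]; exists (1 + v (u N)), N => n /h/(_ (leqnn N)) h1.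
by have := absvD absv (u n - u N) (u N); rewrite subrK; lra.
Qed.

Lemma cauchyD u w : cauchy_seq v u -> cauchy_seq v w ->
  cauchy_seq v (fun n => u n + w n).
Proof.
move=> uN wN e e0; have e2 : 0 < e / 2 by lra.
have [N1 h1] := uN _ e2; have [N2 h2] := wN _ e2.
exists (maxn N1 N2) => m n; rewrite !geq_max => /andP[m1 m2] /andP[n1 n2].
have := absvD absv (u m - u n) (w m - w n).
by rewrite opprD addrACA; have := h1 _ _ m1 n1; have := h2 _ _ m2 n2; lra.
Qed.

Lemma cauchyM u w : cauchy_seq v u -> cauchy_seq v w ->
  cauchy_seq v (fun n => u n * w n).
Proof.
move=> cu cw e e0.
have [C [N1 h1]] := cauchy_bounded cu; have [D [N2 h2]] := cauchy_bounded cw.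
pose B := `|C| + `|D| + 1.
have B0 : 0 < B by rewrite ltr_wpDl // addr_ge0.
have e2 : 0 < e / (2 * B) by rewrite divr_gt0 // mulr_gt0.
have [N3 h3] := cu _ e2; have [N4 h4] := cw _ e2.
exists (maxn (maxn N1 N2) (maxn N3 N4)) => m n.
rewrite !geq_max => /andP[/andP[m1 m2] /andP[m3 m4]] /andP[/andP[n1 n2] /andP[n3 n4]].
have -> : u m * w m - u n * w n = u m * (w m - w n) + w n * (u m - u n) by ring.
apply: le_lt_trans (absvD absv _ _) _; rewrite !(absvM absv).
have uB : v (u m) <= B.
  by rewrite (le_trans (h1 _ m1)) // (le_trans (ler_norm C)) // /B -addrA lerDl addr_ge0.
have wB : v (w n) <= B.
  by rewrite (le_trans (h2 _ n2)) // (le_trans (ler_norm D)) // /B addrAC lerDr addr_ge0.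
have a1 : v (u m) * v (w m - w n) <= B * v (w m - w n).
  by rewrite ler_wpM2r // absv_ge0.
have a2 : v (w n) * v (u m - u n) <= B * v (u m - u n).
  by rewrite ler_wpM2r // absv_ge0.
have h5 := h3 _ _ m3 n3; have h6 := h4 _ _ m4 n4.
apply: (le_lt_trans (lerD a1 a2)); rewrite -mulrDr.
rewrite mulrC -ltr_pdivlMr //.
have -> : e / B = e / (2 * B) + e / (2 * B) by field; rewrite gt_eqF.
by rewrite ltrD.
Qed.

Lemma cauchy_cst a : cauchy_seq v (fun=> a).
Proof. by move=> e e0; exists 0%N => m n _ _; rewrite subrr absv0. Qed.

Lemma cauchy_ext u w : u =1 w -> cauchy_seq v u -> cauchy_seq v w.
Proof. by move=> /funext ->. Qed.

Lemma cauchy_sum (I : Type) (r : seq I) (u : I -> nat -> F) :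
  (forall i, cauchy_seq v (u i)) -> cauchy_seq v (fun n => \sum_(i <- r) u i n).
Proof.
move=> ua; elim: r => [|i r IH].
  by apply: cauchy_ext (cauchy_cst 0) => n; rewrite big_nil.
by apply: cauchy_ext (cauchyD (ua i) IH) => n; rewrite big_cons.
Qed.

Lemma vnull_sum (I : Type) (r : seq I) (u : I -> nat -> F) :
  (forall i, vnull v (u i)) -> vnull v (fun n => \sum_(i <- r) u i n).
Proof.
move=> uN; apply/vnull_conv.
have := @vconv_sum _ _ _ absv _ r xpredT u (fun=> 0) (fun i _ => iffLR (vnull_conv _ _) (uN i)).
by rewrite big1.
Qed.

(** Steinitz exchange on representing sequences. Expanding [b] in [b'] and back gives rational
    matrices E_k that tend to the identity, so their determinants tend to 1; but if n' < n, each E_k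
    factors through dimension n' and has determinant 0. *)
Lemma completion_basis_leq n n' (b : 'I_n -> nat -> F) (b' : 'I_n' -> nat -> F) :
  completion_basis v b -> completion_basis v b' -> (n <= n')%N.
Proof.
move=> [cb sb ib] [cb' sb' ib']; rewrite leqNgt; apply/negP => lt.
have /choice[C hC] i := sb' _ (cb i).
have /choice[D hD] j := sb _ (cb' j).
pose E k := (\matrix_(i, j) C i j k) *m (\matrix_(j, l) D j l k) : 'M[rat]_n.
have EE k i l : E k i l = \sum_j C i j k * D j l k.
  by rewrite mxE; apply: eq_bigr => j _; rewrite !mxE.
(* The expansion of [b i] in [b] itself is unique up to null sequences, by the independence clause
   of [completion_basis]. *)
have null_E i l : vnull v (fun k => (E k i l - (i == l)%:R)%:A).
  apply: (ib (fun l k => E k i l - (i == l)%:R)) => {l}.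
    move=> l; rewrite /rat_cauchy_seq.
    have := cauchyD (@cauchy_sum _ (index_enum 'I_n')
      (fun j k => (C i j k)%:A * (D j l k)%:A) (fun j => cauchyM (proj1 (hC i) j)
        (proj1 (hD j) l))) (cauchy_cst (- (i == l)%:R)%:A).
    apply: cauchy_ext => k; rewrite EE scalerDl scaler_suml; congr (_ + _).
    by apply: eq_bigr => j _; rewrite -scalerAl mul1r scalerA.
  have := vnullB absv (@vnull_sum _ (index_enum 'I_n')
    (fun j k => (C i j k)%:A * - (b' j k - \sum_l D j l k *: b l k))
    (fun j => vnullMb absv (cauchy_bounded (proj1 (hC i) j))
       (vnullN absv (proj2 (hD j))))) (proj2 (hC i)).
  apply: vnull_ext => k.
  under [RHS]eq_bigr => l _ do rewrite scalerBl.
  rewrite big_split /= sumrN.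
  have -> : \sum_l (i == l)%:R *: b l k = b i k.
    rewrite (bigD1 i) //= eqxx scale1r big1 ?addr0 // => l.
    by rewrite eq_sym => /negPf ->; rewrite scale0r.
  rewrite opprB addrA; congr (_ - _).
  under eq_bigr => j _ do rewrite -scalerAl mul1r opprB scalerBr.
  rewrite big_split /= sumrN subrK.
  under eq_bigr => j _ do rewrite scaler_sumr.
  rewrite exchange_big /=; apply: eq_bigr => l _.
  by rewrite EE scaler_suml; apply: eq_bigr => j _; rewrite scalerA.
have detE : vconv v (fun k => \det (map_mx (in_alg F) (E k))) (\det (1%:M : 'M[F]_n)).
  apply: vconv_det => // i l; apply: vnull_ext (null_E i l) => k.
  by rewrite mxE [(1%:M)]/scalar_mx !mxE scalerBl; case: (i == l);
    rewrite /= ?mulr1n ?mulr0n ?scale1r ?scale0r.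
have det0 k : \det (map_mx (in_alg F) (E k)) = 0.
  rewrite det_map_mx /=; suff -> : \det (E k) = 0 by rewrite scale0r.
  apply/eqP/negPn; rewrite -unitfE -[_ \is a _]/(E k \in unitmx) -row_free_unit.
  rewrite -row_leq_rank -ltnNge; apply: leq_ltn_trans lt.
  exact: mulmx_max_rank.
have := vconv_unique absv detE (vconv_ext (fun k => esym (det0 k)) (vconv_cst absv 0)).
by rewrite det1 => /eqP; rewrite oner_eq0.
Qed.

Lemma local_degreeE n (b : 'I_n -> nat -> F) :
  completion_basis v b -> local_degree v = n.
Proof.
move=> bb; rewrite /local_degree; case: xgetP => [m _ [b' bb']|/(_ n)[]].
  by apply/eqP; rewrite eqn_leq (completion_basis_leq bb' bb) (completion_basis_leq bb bb').
by exists b.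
Qed.

End LocalDegreeUnique.

(** * Automorphisms indexed by conjugates, and interpolation *)

(** The condition on r sits inside the existential so that [conj_aut] is total; for r not conjugate
    to x its value is unspecified. *)
Lemma conj_aut_exists (x r : algC) :
  exists nu : {rmorphism algC -> algC}, r \in conjs x -> nu x = r.
Proof.
have [/conjs_autP[nu <-]|nr] := boolP (r \in conjs x); first by exists nu.
by exists idfun.
Qed.

Definition conj_aut (x r : algC) : {rmorphism algC -> algC} :=
  projT1 (cid (conj_aut_exists x r)).

Lemma conj_autE x r : r \in conjs x -> conj_aut x r x = r.
Proof. by rewrite /conj_aut; case: cid. Qed.

Lemma perm_map_conjs (nu : {rmorphism algC -> algC}) x :
  perm_eq (map nu (conjs x)) (conjs x).
Proof.
have uq : uniq (map nu (conjs x)) by rewrite map_inj_uniq ?conjs_uniq //; apply: fmorph_inj.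
apply: uniq_perm => //; first exact: conjs_uniq.
apply: (uniq_min_size uq _ _).2; last by rewrite size_map.
move=> _ /mapP[r rx ->]; rewrite mem_conjs -(minCpoly_conjs rx) -(minCpoly_aut nu).
exact: root_minCpoly.
Qed.

(** The coefficients of an interpolating polynomial are controlled by its values at the nodes. This
    transfers Cauchy and null conditions from values at embeddings to coordinates. Induction on the
    nodes: g = h (X - r) + g(r), and h has divided differences of g as values at the other nodes. *)
Lemma interpolation_bound (R : realType) (F : fieldType) (A : F -> R) (S : seq F) :
  absolute_value A -> uniq S ->
  exists2 C, 0 <= C & forall (g : {poly F}) B, (size g <= size S)%N ->
    (forall r, r \in S -> A g.[r] <= B) -> forall i, A g`_i <= C * B.
Proof.
move=> absA; elim: S => [|r S IH] /=.
  move=> _; exists 0 => // g B; rewrite leqn0 size_poly_eq0 => /eqP -> _ i.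
  by rewrite coef0 absv0 ?mul0r.
move=> /andP[rS uS]; have [C C0 hC] := IH uS.
have [D D0 hD] : exists2 D, 0 <= D & forall r', r' \in S -> (A (r' - r))^-1 <= D.
  exists (\sum_(r' <- S) (A (r' - r))^-1).
    by apply: sumr_ge0 => i _; rewrite invr_ge0 absv_ge0.
  move=> r' r'S; rewrite (big_rem r') //= lerDl.
  by apply: sumr_ge0 => i _; rewrite invr_ge0 absv_ge0.
exists ((1 + A r) * (C * (2 * D)) + 1).
  by rewrite addr_ge0 // !mulr_ge0 // addr_ge0 // absv_ge0.
move=> g B szg hB i.
have B0 : 0 <= B by apply: le_trans (hB r (mem_head _ _)); apply: absv_ge0.
have : root (g - g.[r]%:P) r by rewrite rootE hornerD hornerN hornerC subrr.
move=> /factor_theorem[h Dh].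
have Dg : g = h * ('X - r%:P) + g.[r]%:P by rewrite -Dh subrK.
have szh : (size h <= size S)%N.
  have [->|h0] := eqVneq h 0; first by rewrite size_poly0.
  have : (size (g - g.[r]%:P)%R <= (size S).+1)%N.
    rewrite (leq_trans (size_polyD _ _)) // geq_max szg size_polyN.
    by rewrite (leq_trans (size_polyC_leq1 _)).
  by rewrite Dh size_mul ?polyXsubC_eq0 // size_XsubC addn2.
have hh r' : r' \in S -> A h.[r'] <= 2 * D * B.
  move=> r'S; have nr : r' - r != 0.
    by rewrite subr_eq0; apply: contraNneq rS => <-.
  have -> : h.[r'] = (g.[r'] - g.[r]) / (r' - r).
    by rewrite {1}Dg !hornerE addrK mulfK.
  rewrite (absvM absA) (absvV absA) [2 * D * B]mulrAC.
  apply: ler_pM; [exact: absv_ge0| by rewrite invr_ge0 absv_ge0| |exact: hD].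
  apply: (le_trans (absvB absA _ _)).
  have := hB r' _; rewrite inE r'S orbT => /(_ isT).
  by have := hB r (mem_head _ _); lra.
have hi j : A h`_j <= C * (2 * D) * B by rewrite -mulrA; apply: hC.
rewrite Dg coefD mulrBr coefB coefMX coefMC coefC.
set T := C * (2 * D) * B in hi.
have T0 : 0 <= T by apply: le_trans (hi 0%N); apply: absv_ge0.
have e1 : A (if i == 0%N then 0 else h`_i.-1) <= T by case: ifP => _; rewrite ?absv0.
have e2 : A (h`_i * r) <= A r * T.
  by rewrite (absvM absA) mulrC ler_wpM2l ?absv_ge0.
have e3 : A (if i == 0%N then g.[r] else 0) <= B.
  by case: ifP => _; rewrite ?absv0 // hB ?mem_head.
have := absvB absA (if i == 0%N then 0 else h`_i.-1) (h`_i * r).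
have := absvD absA ((if i == 0%N then 0 else h`_i.-1) - h`_i * r) (if i == 0%N then g.[r] else 0).
have -> : ((1 + A r) * (C * (2 * D)) + 1) * B = T + A r * T + B by rewrite /T; ring.
lra.
Qed.

(** Supplies the rational c at which all places over [w] share one value strictly between 0 and 1,
    as weak approximation requires. *)
Lemma rat_abs_lt1 (R : realType) (w : rat_place) :
  exists q : rat, 0 < rat_abs R w q < 1.
Proof.
case: w => [|p pp] /=.
  exists (2%:R^-1); rewrite fmorphV /= ratr_nat ger0_norm ?invr_ge0 //.
  by rewrite invr_gt0 ltr0n invf_lt1 ?ltr0n ?ltr1n.
exists p%:R; have p0 := prime_gt0 pp.
rewrite pnatr_eq0 eqn0Ngt p0 /=.
rewrite (numq_int p) (denq_int p) /= logn1.
rewrite lognE pp p0 dvdnn divnn p0 logn1 /= sub0r -exprnN expr1.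
by rewrite invr_gt0 ltr0n p0 invf_lt1 ?ltr0n ?ltr1n ?prime_gt1.
Qed.

(** * Places of a number field and their local degrees *)

Section Places.
Variables (R : realType) (w : rat_place) (A : algC -> R).
Hypotheses (absA : absolute_value A) (AE : forall q : rat, A (ratr q) = rat_abs R w q).
Variables (F : fieldExtType rat) (FC : {rmorphism F -> algC}) (x0 : F).
Hypothesis gen : <<1; x0>>%VS = fullv.
Let x := FC x0.

Definition embed (r : algC) : {rmorphism F -> algC} :=
  (conj_aut x r \o FC : {rmorphism F -> algC}).

Lemma embed_gen r : r \in conjs x -> embed r x0 = r.
Proof. exact: conj_autE. Qed.

Lemma num_field_horner (y : F) :
  exists p : {poly rat}, y = (map_poly (in_alg F) p).[x0].
Proof.
have /Fadjoin_polyP[p /polyOverP p1 ->] : y \in <<1; x0>>%VS by rewrite gen memvf.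
have a_ i := sig_eqW (vlineP _ _ (p1 i)).
exists (\poly_(i < size p) sval (a_ i)); congr _.[_].
apply/polyP => i; rewrite coef_map coef_poly /=.
case: ltnP => [_|szi]; first by case: (a_ i).
by rewrite nth_default ?scale0r.
Qed.

Lemma map_in_alg (f : {rmorphism F -> algC}) (p : {poly rat}) :
  map_poly f (map_poly (in_alg F) p) = map_poly ratr p.
Proof.
rewrite -map_poly_comp; apply: eq_map_poly => b /=.
by rewrite alg_num_field fmorph_rat.
Qed.

Lemma embed_ext (f g : {rmorphism F -> algC}) : f x0 = g x0 -> f =1 g.
Proof.
move=> fg y; have [p ->] := num_field_horner y.
by rewrite -!horner_map !map_in_alg /= fg.
Qed.

(** The characteristic polynomial of multiplication by z on F over the rationals, written through
    the embeddings of F. *)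
Definition embed_poly (z : F) : {poly algC} :=
  \prod_(r <- conjs x) ('X - (embed r z)%:P).

(** An automorphism nu of [algC] only permutes the factors, because nu composed with [embed r] is
    [embed (nu r)]; both send [x0] to [nu r]. *)
Lemma embed_poly_rat z : exists2 q : {poly rat},
  embed_poly z = map_poly ratr q & root (map_poly (in_alg F) q) z.
Proof.
have cr i : (embed_poly z)`_i \in Crat.
  apply: Crat_aut_fixed => nu; rewrite -coef_map.
  suff -> : map_poly nu (embed_poly z) = embed_poly z by [].
  transitivity (\prod_(r <- map nu (conjs x)) ('X - (embed r z)%:P)); last first.
    exact: perm_big (perm_map_conjs nu x).
  rewrite /embed_poly rmorph_prod big_map big_seq [RHS]big_seq.
  apply: eq_bigr => r rx; rewrite [LHS]map_polyXsubC; congr ('X - _%:P).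
  have nrx : nu r \in conjs x by rewrite -(perm_mem (perm_map_conjs nu x)) map_f.
  apply: (@embed_ext (nu \o embed r : {rmorphism F -> algC})) => /=.
  by rewrite -[RHS]/(embed (nu r) x0) embed_gen // -[in RHS](embed_gen rx).
have q_ i := sig_eqW (CratP _ (cr i)).
exists (\poly_(i < size (embed_poly z)) sval (q_ i)).
  apply/polyP => i; rewrite coef_map coef_poly /=.
  case: ltnP => [_|szi]; first by case: (q_ i).
  by rewrite nth_default ?rmorph0.
rewrite -(fmorph_root FC) map_in_alg.
set q := map_poly _ _; have <- : embed_poly z = q.
  apply/polyP => i; rewrite coef_map coef_poly /=.
  case: ltnP => [_|szi]; first by case: (q_ i).
  by rewrite nth_default ?rmorph0.
have <- : embed x z = FC z by apply: embed_ext; rewrite embed_gen ?conjs_refl.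
rewrite /embed_poly -(big_map (fun r => embed r z) xpredT (fun r => 'X - r%:P)).
by rewrite root_prod_XsubC; apply/mapP; exists x; rewrite ?conjs_refl.
Qed.

Lemma absv_alg (f : {rmorphism F -> algC}) (q : rat) : A (f q%:A) = rat_abs R w q.
Proof. by rewrite alg_num_field fmorph_rat AE. Qed.

Lemma embed_place r : place_over w (A \o embed r).
Proof.
by split; [exact: absv_comp | move=> q /=; rewrite -[RHS](absv_alg (embed r))].
Qed.

(** If v were none of the A \o embed r, some z_k would tend to 1 at v and to 0 at all of those. All
    roots of the characteristic polynomial of z_k then tend to 0, so the polynomial tends to X^n for
    A. Its coefficients are rational, so it does so for v as well, and evaluating at z_k gives 0 = 1
    in the limit. *)
Lemma place_embed v : place_over w v ->
  exists2 r, r \in conjs x & v = A \o embed r.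
Proof.
move=> [absv vE]; apply: contrapT => nex.
have [c c01] := rat_abs_lt1 R w.
have absu r : absolute_value (A \o embed r) by apply: absv_comp.
have uc r : (A \o embed r) c%:A = v c%:A by rewrite vE [LHS]absv_alg.
have vc : 0 < v c%:A < 1 by rewrite vE.
have [r rx vr|z [zv zu]] := weak_approximation (s := conjs x) absv absu vc uc.
  by apply: nex; exists r.
have /choice[q hq] k : exists q : {poly rat}, embed_poly (z k) = map_poly ratr q /\
    root (map_poly (in_alg F) q) (z k).
  by have [q ? ?] := embed_poly_rat (z k); exists q.
pose n := size (conjs x).
have szq k : size (map_poly (in_alg F) (q k)) = n.+1.
  rewrite size_map_poly -(size_map_poly (ratr : rat -> algC)) -(hq k).1.
  by rewrite /embed_poly -(big_map (fun r => embed r (z k)) xpredT (fun r => 'X - r%:P))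
       size_prod_XsubC size_map.
have convA i : vconv A (fun k => (embed_poly (z k))`_i) ('X^n : {poly algC})`_i.
  have <- : \prod_(r <- conjs x) ('X - 0%:P) = 'X^n :> {poly algC}.
    by rewrite subr0 big_const_seq count_predT iter_mulr_1.
  apply: (vconv_prod_XsubC absA (u := fun r k => embed r (z k)) (a := fun=> 0)) => r rx.
  by apply: (iffLR (vnull_conv _ _)); exact: (zu r rx).
have convv i : vconv v (fun k => (map_poly (in_alg F) (q k))`_i) ('X^n : {poly F})`_i.
  move=> e /(convA i)[N h]; exists N => k /h.
  rewrite (hq k).1 !coef_map /= !coefXn -ratr_nat -rmorphB AE -vE.
  by rewrite scalerBl scaler_nat.
have := vconv_horner absv (fun k => eq_leq (szq k)) _ convv zv.
rewrite size_polyXn => /(_ (leqnn _)).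
rewrite hornerXn expr1n => /(vconv_unique absv)/(_ (vconv_ext _ (vconv_cst absv 0))) h.
have /eqP : (1 : F) = 0 by apply: h => k; apply/esym/eqP; exact: (hq k).2.
by rewrite oner_eq0.
Qed.

(** The A-closure of the rationals in [algC], in the role of the completion of the rationals at
    [w]. *)
Definition rat_limit (a : algC) : Prop :=
  exists q : nat -> rat, vconv A (fun k => ratr (q k)) a.

Lemma rat_limit_rat q : rat_limit (ratr q).
Proof. by exists (fun=> q); apply: vconv_cst. Qed.

Lemma rat_limitD a b : rat_limit a -> rat_limit b -> rat_limit (a + b).
Proof.
move=> [p pa] [q qb]; exists (fun k => p k + q k).
by apply: vconv_ext (vconvD absA pa qb) => k; rewrite rmorphD.
Qed.

Lemma rat_limitM a b : rat_limit a -> rat_limit b -> rat_limit (a * b).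
Proof.
move=> [p pa] [q qb]; exists (fun k => p k * q k).
by apply: vconv_ext (vconvM absA pa qb) => k; rewrite rmorphM.
Qed.

Lemma rat_limitN a : rat_limit a -> rat_limit (- a).
Proof.
move=> [p pa]; exists (fun k => - p k).
by apply: vconv_ext (vconvN absA pa) => k; rewrite rmorphN.
Qed.

Variable r0 : algC.
Hypothesis r0x : r0 \in conjs x.
Let v := A \o embed r0.

Definition same_place : seq algC :=
  [seq r <- conjs x | `[< A \o embed r = A \o embed r0 >]].

Let S := same_place.
Let m := size S.
(** Classically, the factor over the completed rationals of the minimal polynomial of x that belongs
    to the place v. *)
Let fS : {poly algC} := \prod_(r <- S) ('X - r%:P).

Lemma same_placeP r : r \in S -> r \in conjs x /\ A \o embed r = v.
Proof. by rewrite mem_filter => /andP[/asboolP -> ->]. Qed.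

Lemma same_place_refl : r0 \in S.
Proof. by rewrite mem_filter r0x andbT; apply/asboolP. Qed.

(* With e_k -> 1 at v and e_k -> 0 at the other places over w, the rational
   characteristic polynomials of e_k x0 tend to fS 'X^(n - m). *)
Lemma same_place_poly_limit i : rat_limit fS`_i.
Proof.
have absv : absolute_value v by apply: absv_comp.
have [c c01] := rat_abs_lt1 R w.
have absu r : absolute_value (A \o embed r) by apply: absv_comp.
have uc r : (A \o embed r) c%:A = v c%:A.
  by rewrite [LHS]absv_alg [RHS]absv_alg.
have vc : 0 < v c%:A < 1 by rewrite [v _]absv_alg.
pose T := [seq r <- conjs x | r \notin S].
have [r|e [ev eu]] := weak_approximation (s := T) absv absu vc uc.
  rewrite mem_filter => /andP[rS rx] vr; case/negP: rS.
  by rewrite mem_filter rx andbT; apply/asboolP.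
have /choice[q hq] k : exists q : {poly rat}, embed_poly (e k * x0) = map_poly ratr q.
  by have [q ? ?] := embed_poly_rat (e k * x0); exists q.
pose a r := if r \in S then r else 0.
pose d := size T.
have Dprod : \prod_(r <- conjs x) ('X - (a r)%:P) = fS * 'X^d.
  rewrite (bigID (mem S)) /= -big_filter.
  have eS : [seq r <- conjs x | r \in S] = S.
    apply: eq_in_filter => r rx; rewrite /S /same_place mem_filter rx andbT //.
  rewrite eS -[in X in _ * X]big_filter; congr (_ * _).
    by rewrite /fS big_seq [RHS]big_seq; apply: eq_bigr => r rS; rewrite /a rS.
  rewrite big_seq (eq_bigr (fun=> 'X)) -?big_seq ?big_const_seq ?count_predT ?iter_mulr_1 //.
  by move=> r; rewrite mem_filter /a => /andP[/negPf -> _]; rewrite subr0.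
exists (fun k => (q k)`_(i + d)).
have := @vconv_prod_XsubC _ _ _ absA _ (conjs x) (fun r k => embed r (e k * x0)) a _ (i + d).
rewrite Dprod coefMXn ltnNge leq_addl /= addnK.
have -> : (fun k => (\prod_(i0 <- conjs x) ('X - (embed i0 (e k * x0))%:P))`_(i + d)) =
          (fun k => ratr (q k)`_(i + d)).
  by apply/funext => k; rewrite -coef_map -hq.
apply=> r rx.
have -> : (fun k => embed r (e k * x0)) = (fun k => embed r (e k) * r).
  by apply/funext => k; rewrite rmorphM /= -[X in _ * X]/(embed r x0) embed_gen.
rewrite /a; case: ifPn => rS.
  rewrite -[X in vconv _ _ X]mul1r; apply: vconvM => //; last exact: vconv_cst.
  have [_ Dr] := same_placeP rS; move=> eps /ev[N h]; exists N => k /h.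
  by rewrite -Dr /= !rmorphB !rmorph1.
have -> : 0 = 0 * r by rewrite mul0r.
apply: vconvM => //; last exact: vconv_cst.
apply: (iffLR (vnull_conv _ _)); apply: (eu r).
by rewrite mem_filter rS rx.
Qed.

(** Write y = p(x0) with p rational and reduce p modulo the monic [fS]: the remainder has degree
    below [m], the same values on [S], and coefficients in the closure of the rationals. *)
Lemma same_place_interpolation (y : F) : exists g : {poly algC},
  [/\ (size g <= m)%N, forall i, rat_limit g`_i &
      forall r, r \in S -> g.[r] = embed r y].
Proof.
have [p ->] := num_field_horner y.
suff [g [sg lg hg]] : exists g : {poly algC}, [/\ (size g <= m)%N,
    forall i, rat_limit g`_i & forall r, r \in S -> g.[r] = (map_poly ratr p).[r]].
  exists g; split=> // r rS; rewrite hg // -horner_map map_in_alg.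
  by rewrite -[(GRing.RMorphism.sort _) x0]/(embed r x0) embed_gen //; case: (same_placeP rS).
have m0 : (0 < m)%N by rewrite /m; case: S same_place_refl.
have szf : size fS = m.+1 by rewrite size_prod_XsubC.
have fm : fS`_m = 1.
  have := monic_prod_XsubC S xpredT id; rewrite monicE lead_coefE -/fS szf /=.
  by move/eqP.
elim/poly_ind: p => [|p c [g [sg lg hg]]].
  exists 0; rewrite size_poly0; split=> // [i|r _]; last by rewrite map_poly0 !horner0.
  by rewrite coef0 -(rmorph0 (ratr : rat -> algC)); apply: rat_limit_rat.
(* One Horner step; subtracting a multiple of the monic [fS] cancels the coefficient of degree m. *)
pose h := g * 'X + (ratr c)%:P - g`_m.-1 *: fS.
have lh i : rat_limit h`_i.
  rewrite /h coefB coefD coefMX coefC coefZ.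
  have l0 : rat_limit 0 by rewrite -(rmorph0 (ratr : rat -> algC)); apply: rat_limit_rat.
  apply: rat_limitD; last exact/rat_limitN/rat_limitM/same_place_poly_limit.
  by apply: rat_limitD; case: ifP => // _; apply: rat_limit_rat.
exists h; split=> //.
  apply/leq_sizeP => j; rewrite leq_eqVlt => /orP[/eqP<-|mj].
    rewrite /h coefB coefD coefMX coefC coefZ fm mulr1 eqn0Ngt m0 /=.
    by rewrite addr0 subrr.
  rewrite /h coefB coefD coefMX coefC coefZ.
  have j0 : j != 0%N by rewrite -lt0n (leq_trans _ mj).
  rewrite (negPf j0) [fS`_j]nth_default ?szf // mulr0 subr0 addr0 nth_default //.
  by rewrite (leq_trans sg) // -ltnS prednK // lt0n.
move=> r rS; have fr : fS.[r] = 0 by apply/eqP; rewrite -[_ == _]/(root _ _) root_prod_XsubC.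
have -> : map_poly ratr (p * 'X + c%:P) = map_poly ratr p * 'X + (ratr c)%:P :> {poly algC}.
  by rewrite rmorphD rmorphM /= map_polyX map_polyC.
by rewrite /h !hornerE fr hg // mulr0 subr0.
Qed.

(** All embeddings in [S] give elements of F the same size, so [interpolation_bound] bounds
    coordinates by v. This gives independence, and shows that the coordinates of a Cauchy sequence
    are Cauchy. *)
Lemma same_place_basis :
  completion_basis v (fun (i : 'I_m) (k : nat) => x0 ^+ i).
Proof.
have absv : absolute_value v by apply: absv_comp.
have uS : uniq S by rewrite filter_uniq // conjs_uniq.
have [C C0 hC] := interpolation_bound absA uS.
have valg (q : rat) : v q%:A = A (ratr q) by rewrite [LHS]absv_alg AE.
have vS r y : r \in S -> A (embed r y) = v y.
  by move=> /same_placeP[_ <-].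
have vx : embed r0 x0 = r0 by apply: embed_gen.
split=> [i|y cy|c cc nc].
- exact: cauchy_cst.
- have /choice[g hg] k := same_place_interpolation (y k).
  (* The coefficients of the k-th interpolant are only limits of rationals; replacing them by
     rationals within 1 / (k + 1) changes the sums by a null sequence. *)
  have /choice[c hc] (ik : 'I_m * nat) : exists q : rat,
      A (ratr q - (g ik.2)`_ik.1) < (ik.2.+1%:R)^-1.
    have [_ lg _] := hg ik.2; have [q ql] := lg ik.1.
    have [|N h] := ql (ik.2.+1%:R)^-1; first by rewrite invr_gt0 ltr0n.
    by exists (q N); apply: h.
  have small e : 0 < e -> exists N, forall k, (N <= k)%N -> (k.+1%:R : R)^-1 < e.
    move=> e0; have /cvgrPdist_lt /(_ e e0)[N _ h] := @cvg_harmonic R.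
    exists N => k /h /=; rewrite sub0r normrN ger0_norm //.
  exists (fun i k => c (i, k)); split=> [i|].
  + move=> e e0; have e3 : 0 < e / 3 by lra.
    have [N1 h1] := small _ e3.
    have [|N2 h2] := cy (e / 3 / (C + 1)); first by rewrite divr_gt0 // ltr_wpDl.
    exists (maxn N1 N2) => k l; rewrite !geq_max => /andP[k1 k2] /andP[l1 l2].
    rewrite -scalerBl valg rmorphB /=.
    have -> : ratr (c (i, k)) - ratr (c (i, l)) = (ratr (c (i, k)) - (g k)`_i) -
       (ratr (c (i, l)) - (g l)`_i) + ((g k)`_i - (g l)`_i) by ring.
    have hk := hc (i, k); have hl := hc (i, l); rewrite /= in hk hl.
    have {}hk := lt_trans hk (h1 _ k1); have {}hl := lt_trans hl (h1 _ l1).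
    have := absvD absA ((ratr (c (i, k)) - (g k)`_i) - (ratr (c (i, l)) - (g l)`_i))
                       ((g k)`_i - (g l)`_i).
    have := absvB absA (ratr (c (i, k)) - (g k)`_i) (ratr (c (i, l)) - (g l)`_i).
    have : A ((g k)`_i - (g l)`_i) <= C * v (y k - y l).
      rewrite -coefB; apply: hC => [|r rS].
        rewrite (leq_trans (size_polyD _ _)) // size_polyN geq_max.
        by have [-> _ _] := hg k; have [-> _ _] := hg l.
      have [_ _ ek] := hg k; have [_ _ el] := hg l.
      by rewrite hornerD hornerN ek // el // -rmorphB vS.
    have : C * v (y k - y l) <= (C + 1) * v (y k - y l).
      by rewrite ler_wpM2r ?absv_ge0 // lerDl.
    have : (C + 1) * v (y k - y l) < e / 3.
      by rewrite mulrC -ltr_pdivlMr ?ltr_wpDl // h2.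
    move: hk hl; lra.
  + pose K := \sum_(i < m) A r0 ^+ i.
    have K0 : 0 <= K by apply: sumr_ge0 => i _; rewrite exprn_ge0 // absv_ge0.
    move=> e e0; have [|N h] := small (e / (K + 1)); first by rewrite divr_gt0 // ltr_wpDl.
    exists N => k /h {}h; have [sg _ eg] := hg k.
    rewrite -(vS r0) ?same_place_refl // rmorphB rmorph_sum -eg ?same_place_refl //.
    rewrite (horner_coef_wide _ sg) -sumrB.
    apply: le_lt_trans (absv_sum absA _ _ _) _.
    apply: (@le_lt_trans _ _ (K * (k.+1%:R)^-1)).
      rewrite /K mulr_suml; apply: ler_sum => i _.
      rewrite rmorphZ_num rmorphXn vx -mulrBl.
      rewrite (absvM absA) (absvX absA) mulrC ler_wpM2l ?exprn_ge0 ?absv_ge0 //.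
      by rewrite (absvBC absA) ltW //; exact: (hc (i, k)).
    apply: (@le_lt_trans _ _ ((K + 1) * (k.+1%:R)^-1)).
      by rewrite ler_wpM2r ?invr_ge0 ?ler0n // lerDl.
    by rewrite mulrC -ltr_pdivlMr // ltr_wpDl.
- move=> i e e0; have [|N h] := nc (e / (C + 1)); first by rewrite divr_gt0 // ltr_wpDl.
  exists N => k /h {}h; rewrite valg.
  pose G : {poly algC} := \poly_(i < m) (if insub i is Some j then ratr (c j k) else 0).
  have -> : ratr (c i k) = G`_i by rewrite coef_poly ltn_ord valK.
  set s := \sum_(i < m) _ in h.
  apply: (@le_lt_trans _ _ (C * v s)).
    apply: hC => [|r rS]; first exact: size_poly.
    rewrite -(vS r) // /s rmorph_sum /G horner_poly.
    rewrite le_eqVlt; apply/orP; left; apply/eqP; congr (A _).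
    apply: eq_bigr => j _; rewrite valK rmorphZ_num rmorphXn embed_gen //.
    by case: (same_placeP rS).
  apply: (@le_lt_trans _ _ ((C + 1) * v s)).
    by rewrite ler_wpM2r ?absv_ge0 // lerDl.
  by rewrite mulrC -ltr_pdivlMr ?ltr_wpDl //; exact: h.
Qed.

Lemma local_degree_embed : local_degree v = size same_place.
Proof.
by apply: local_degreeE same_place_basis; apply: absv_comp.
Qed.

End Places.

(** * The p-adic absolute value on the algebraic numbers *)

Definition is_subring (F : fieldType) (B : set F) : Prop :=
  [/\ B 1, forall x y, B x -> B y -> B (x - y) & forall x y, B x -> B y -> B (x * y)].

Section Subring.
Variables (F : fieldType) (B : set F).
Hypothesis ringB : is_subring B.

Lemma subring1 : B 1. Proof. by case: ringB. Qed.
Lemma subringB x y : B x -> B y -> B (x - y). Proof. by case: ringB => _ h _; apply: h. Qed.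
Lemma subringM x y : B x -> B y -> B (x * y). Proof. by case: ringB => _ _ h; apply: h. Qed.
Lemma subring0 : B 0. Proof. by rewrite -(subrr 1); apply: subringB subring1 subring1. Qed.
Lemma subringN x : B x -> B (- x).
Proof. by rewrite -sub0r; apply: subringB subring0. Qed.
Lemma subringD x y : B x -> B y -> B (x + y).
Proof. by move=> Bx By; rewrite -[y]opprK; apply/subringB/subringN. Qed.
Lemma subringX x n : B x -> B (x ^+ n).
Proof. by move=> Bx; elim: n => [|n IH]; [exact: subring1 | rewrite exprS; apply: subringM]. Qed.
Lemma subring_nat n : B n%:R.
Proof. by elim: n => [|n IH]; [exact: subring0 | rewrite -natr1; apply/subringD/subring1]. Qed.
Lemma subring_sum (I : Type) (r : seq I) (P : pred I) (G : I -> F) :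
  (forall i, P i -> B (G i)) -> B (\sum_(i <- r | P i) G i).
Proof. by move=> h; elim/big_ind: _ => //; [exact: subring0 | exact: subringD]. Qed.

Definition adjoin_subring (x : F) : set F :=
  [set y | exists2 g : {poly F}, forall i, B g`_i & y = g.[x]]%classic.

Lemma adjoin_is_subring x : is_subring (adjoin_subring x).
Proof.
split.
- exists 1; last by rewrite hornerC.
  by move=> i; rewrite coef1; apply: subring_nat.
- move=> _ _ [g gB ->] [h hB ->]; exists (g - h); last by rewrite hornerD hornerN.
  by move=> i; rewrite coefB; apply: subringB.
- move=> _ _ [g gB ->] [h hB ->]; exists (g * h); last by rewrite hornerM.
  by move=> i; rewrite coefM; apply: subring_sum => j _; apply: subringM.
Qed.

Lemma adjoin_subring_sub x y : B y -> adjoin_subring x y.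
Proof.
move=> By; exists y%:P; last by rewrite hornerC.
by move=> i; rewrite coefC; case: ifP => // _; apply: subring0.
Qed.

Lemma adjoin_subring_gen x : adjoin_subring x x.
Proof.
exists 'X; last by rewrite hornerX.
by move=> i; rewrite coefX; apply: subring_nat.
Qed.

Variable p : nat.
Hypothesis notVp : ~ B p%:R^-1.

(** Says that 1/p lies in B[x], with a witness of degree at most n; the degree drives the descent
    below. *)
Definition unit_repr (n : nat) (x : F) : Prop := exists g : {poly F},
  [/\ (size g <= n.+1)%N, forall i, B g`_i & p%:R * g.[x] = 1].

Lemma unit_repr0 x : ~ unit_repr 0 x.
Proof.
move=> [g [sg gB]]; rewrite (size1_polyC sg) hornerC => h; apply: notVp.
have p0 : p%:R != 0 :> F.
  by apply: contra_eq_neq h => ->; rewrite mul0r eq_sym oner_eq0.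
by have -> : p%:R^-1 = g`_0 by apply: (mulfI p0); rewrite divff // h.
Qed.

(** Chevalley's degree reduction. Multiplying 1 = p c(1/x) by x^(n+1) expresses (1 - p c_0) x^(n+1)
    as h(x) with h of degree at most n. Substituting this into (1 - p c_0) times 1 = p g(x) removes
    the top term of g. *)
Lemma unit_repr_step n k x : x != 0 -> (k <= n.+1)%N ->
  unit_repr n.+1 x -> unit_repr k x^-1 -> unit_repr n x.
Proof.
move=> x0 kn [g [sg gB gx]] [c [sc cB cx]].
pose g0 := \poly_(i < n.+1) g`_i.
pose h := \poly_(i < n.+1) (p%:R * c`_(n.+1 - i)).
have Dg : g.[x] = g0.[x] + g`_n.+1 * x ^+ n.+1.
  by rewrite (horner_coef_wide _ sg) big_ord_recr /= horner_poly.
have Dh : h.[x] = x ^+ n.+1 * (1 - p%:R * c`_0).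
  have szc : (size c <= n.+2)%N by apply: leq_trans sc _.
  have -> : 1 - p%:R * c`_0 = p%:R * (c.[x^-1] - c`_0) by rewrite mulrBr cx.
  rewrite (horner_coef_wide _ szc) big_ord_recl /= expr0 mulr1 addrAC subrr add0r.
  rewrite horner_poly (reindex_inj rev_ord_inj) /= !mulr_sumr; apply: eq_bigr => i _.
  rewrite subKn // [bump _ _]add1n.
  rewrite [RHS]mulrCA -mulrA; congr (_ * _); rewrite [RHS]mulrCA; congr (_ * _).
  by rewrite exprVn expfB_cond // (negPf x0) add0n.
exists ((c`_0)%:P + (1 - p%:R * c`_0) *: g0 + g`_n.+1 *: h); split.
- rewrite (leq_trans (size_polyD _ _)) // geq_max.
  rewrite (leq_trans (size_polyD _ _)) /=; last first.
    rewrite geq_max (leq_trans (size_polyC_leq1 _)) //.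
    by rewrite (leq_trans (size_scale_leq _ _)) // size_poly.
  by rewrite (leq_trans (size_scale_leq _ _)) // size_poly.
- have Bp := subring_nat p.
  move=> i; rewrite !coefD !coefZ !coef_poly coefC; apply: subringD; first apply: subringD.
  + by case: ifP => // _; apply: subring0.
  + apply: subringM; first by apply/subringB/subringM => //; exact: subring1.
    by case: ifP => // _; apply: subring0.
  + apply: subringM => //; case: ifP => // _; last exact: subring0.
    exact: subringM.
- rewrite !hornerE Dh.
  have e : p%:R * g0.[x] = 1 - p%:R * (g`_n.+1 * x ^+ n.+1).
    by move: gx; rewrite Dg mulrDr => /(canRL (addrK _)).
  have -> : p%:R * (c`_0 + (1 - p%:R * c`_0) * g0.[x] +
      g`_n.+1 * (x ^+ n.+1 * (1 - p%:R * c`_0))) =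
    p%:R * c`_0 + (1 - p%:R * c`_0) * (p%:R * g0.[x]) +
      p%:R * g`_n.+1 * (x ^+ n.+1 * (1 - p%:R * c`_0)) by ring.
  by rewrite e; ring.
Qed.

Lemma unit_repr_contra n k x : x != 0 -> unit_repr n x -> unit_repr k x^-1 -> False.
Proof.
move: {2}(n + k)%N (leqnn (n + k)) => N; elim: N n k x => [|N IH] n k x nk x0.
  by move: nk; rewrite leqn0 addn_eq0 => /andP[/eqP -> _] /unit_repr0.
wlog kn : n k x nk x0 / (k <= n)%N.
  move=> W rx rx'; have [kn|/ltnW nk'] := leqP k n; first exact: (W n k x).
  by apply: (W k n x^-1) => //; rewrite ?invr_eq0 ?invrK // addnC.
case: n nk kn => [_ _ /unit_repr0 //|n nk kn rx rx'].
by apply: (IH n k x) => //; apply: unit_repr_step kn rx rx'.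
Qed.

End Subring.

(** Take B maximal among subrings without 1/p; the image of the integers is one. If neither x nor
    1/x lay in B, maximality would put 1/p in both B[x] and B[1/x], which the descent excludes. *)
Lemma valuation_ring_exists (F : fieldType) (p : nat) :
  p%:R != 0 :> F -> (forall n : int, n%:~R * p%:R != 1 :> F) ->
  exists B : set F, [/\ is_subring B, ~ B p%:R^-1 & forall x, B x \/ B x^-1].
Proof.
move=> p0 np.
pose P (B : set F) := (B `<=` set0)%classic \/ is_subring B /\ ~ B p%:R^-1.
have [C FP totF|B [PB maxB]] := @Zorn_bigcup F P.
  have [neC|] := pselect (exists X, C X /\ is_subring X /\ ~ X p%:R^-1); last first.
    move=> nC; left=> x [X CX Xx]; have [X0|h] := FP X CX; first exact: (X0 x Xx).
    by apply: nC; exists X.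
  have sub X : C X -> exists Y, [/\ C Y, (X `<=` Y)%classic & is_subring Y].
    move=> CX; have [X0|[h _]] := FP X CX; last by exists X; split.
    by have [Y [CY [rY _]]] := neC; exists Y; split=> // x /X0.
  have two x y : (\bigcup_(X in C) X)%classic x -> (\bigcup_(X in C) X)%classic y ->
      exists Y, [/\ C Y, Y x, Y y & is_subring Y].
    move=> [X CX Xx] [Y CY Yy].
    have [XY|YX] := totF X Y CX CY.
      by have [Z [CZ YZ rZ]] := sub Y CY; exists Z; split=> //; [apply/YZ/XY|apply: YZ].
    by have [Z [CZ XZ rZ]] := sub X CX; exists Z; split=> //; [apply: XZ|apply/XZ/YX].
  right; split; last first.
    move=> [X CX Xp]; have [X0|[_ h]] := FP X CX; [exact: (X0 _ Xp) | exact: h].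
  split.
  - by have [Y [CY [rY _]]] := neC; exists Y => //; apply: subring1 rY.
  - by move=> x y bx /(two _ _ bx)[Y [CY Yx Yy rY]]; exists Y => //; apply: subringB.
  - by move=> x y bx /(two _ _ bx)[Y [CY Yx Yy rY]]; exists Y => //; apply: subringM.
pose Z : set F := [set x | exists n : int, x = n%:~R]%classic.
have rZ : is_subring Z.
  split; first by exists 1.
  - by move=> _ _ [n ->] [k ->]; exists (n - k); rewrite intrB.
  - by move=> _ _ [n ->] [k ->]; exists (n * k); rewrite intrM.
have ZP : ~ Z p%:R^-1.
  by move=> [n hn]; have := np n; rewrite -hn mulVf // eqxx.
have [B0|[rB nB]] := PB.
  exfalso; apply: (maxB Z); last by right.
  by split=> [x /B0 //|]; move=> /(_ 1) /(_ (subring1 rZ)) /B0.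
exists B; split=> // x.
have [->|x0] := eqVneq x 0; first by left; apply: subring0.
apply: contrapT => /not_orP[nx nx'].
have repr y : ~ B y -> exists n, unit_repr B p n y.
  move=> ny; apply: contrapT => nr; apply: (maxB (adjoin_subring B y)).
    split=> [z|]; first exact: adjoin_subring_sub.
    by move=> /(_ y) /(_ (adjoin_subring_gen rB y)).
  right; split; first exact: adjoin_is_subring.
  move=> [g gB hg]; apply: nr; exists (size g), g; split=> //.
  by rewrite -hg divff.
have [n rn] := repr x nx; have [k rk] := repr _ nx'.
exact: (unit_repr_contra rB nB x0 rn rk).
Qed.

(** * Units and maximal ideal of a valuation ring *)

Section ValuationRing.
Variables (F : fieldType) (B : set F).
Hypotheses (ringB : is_subring B) (valB : forall x, B x \/ B x^-1).

Definition vunit (x : F) : Prop := [/\ x != 0, B x & B x^-1].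

Lemma vunit1 : vunit 1.
Proof. by split; rewrite ?oner_eq0 ?invr1 //; apply: subring1. Qed.

Lemma vunitM x y : vunit x -> vunit y -> vunit (x * y).
Proof.
move=> [x0 Bx Bx'] [y0 By By']; split; first by rewrite mulf_neq0.
  exact: subringM.
by rewrite invfM; apply: subringM.
Qed.

Lemma vunitV x : vunit x -> vunit x^-1.
Proof. by move=> [x0 Bx Bx']; split; rewrite ?invrK ?invr_eq0. Qed.

Lemma vunitX x n : vunit x -> vunit (x ^+ n).
Proof. by move=> ux; elim: n => [|n IH]; [exact: vunit1|rewrite exprS; apply: vunitM]. Qed.

Definition vmax (x : F) : Prop := B x /\ ~ vunit x.

Lemma vmaxD x y : vmax x -> vmax y -> vmax (x + y).
Proof.
(* Of two nonzero elements one divides the other in B, and the sum is then a multiple of the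
   divisor. *)
suff W a b : b != 0 -> B (a / b) -> vmax a -> vmax b -> vmax (a + b).
  move=> mx my; have [->|y0] := eqVneq y 0; first by rewrite addr0.
  have [->|x0] := eqVneq x 0; first by rewrite add0r.
  have [|] := valB (x / y); first by move=> h; apply: W.
  by rewrite invfM invrK mulrC => h; rewrite addrC; apply: W.
move=> b0 ab [Ba na] [Bb nb]; split; first exact: subringD.
move=> [ab0 _ Bab']; apply: nb; split=> //.
have -> : b^-1 = (1 + a / b) * (a + b)^-1.
  by rewrite -{1}(divff b0) -mulrDl addrC mulrAC divff // mul1r.
by apply: subringM => //; apply: subringD => //; apply: subring1.
Qed.

Lemma vmaxM x y : B x -> vmax y -> vmax (x * y).
Proof.
move=> Bx [By ny]; split; first exact: subringM.
move=> [xy0 _ Bxy]; apply: ny; split=> //.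
  by apply: contraNneq xy0 => ->; rewrite mulr0.
have x0 : x != 0 by apply: contraNneq xy0 => ->; rewrite mul0r.
have -> : y^-1 = x * (x * y)^-1 by rewrite invfM mulrA divff // mul1r.
exact: subringM.
Qed.

Lemma vmax0 : vmax 0.
Proof. by split; [exact: subring0 | move=> []; rewrite eqxx]. Qed.

Lemma vring_root x n : (0 < n)%N -> B (x ^+ n) -> B x.
Proof.
move=> n0 Bxn; have [//|Bx'] := valB x.
have [->|x0] := eqVneq x 0; first exact: subring0.
have -> : x = x ^+ n * x^-1 ^+ n.-1.
  by rewrite exprVn -{1}(prednK n0) exprS mulfK // expf_neq0.
by apply: subringM => //; apply: subringX.
Qed.

(* Divide by a term of maximal size: if no other term had that size, -1 would
   be a sum of nonunits. *)
Lemma vunit_ratio (s : seq F) : \sum_(t <- s) t = 0 -> has (fun t => t != 0) s ->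
  exists i j, [/\ (i < j < size s)%N, s`_i != 0 & vunit (s`_j / s`_i)].
Proof.
move=> s0 hs.
have [k [ks k0 hk]] : exists k, [/\ (k < size s)%N, s`_k != 0
    & forall t, t \in s -> B (t / s`_k)].
  move: {s0} hs; elim: s => [//|a s IH] /=.
  have [hs|/hasPn ns] := boolP (has (fun t => t != 0) s); last first.
    rewrite orbF => a0; exists 0%N; split=> // t; rewrite inE => /predU1P[->|/ns].
      by rewrite /= divff //; apply: subring1.
    by rewrite negbK => /eqP ->; rewrite mul0r; apply: subring0.
  move=> _; have [k [ks k0 hk]] := IH hs.
  have [ak|] := valB (a / s`_k).
    by exists k.+1; split=> // t; rewrite inE => /predU1P[->|/hk].
  rewrite invfM invrK mulrC => ka.
  have [a0|a0] := eqVneq a 0.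
    exists k.+1; split=> // t; rewrite inE => /predU1P[->|/hk //].
    by rewrite a0 mul0r; apply: subring0.
  exists 0%N; split=> // t; rewrite inE /= => /predU1P[->|ts].
    by rewrite divff //; apply: subring1.
  have -> : t / a = t / s`_k * (s`_k / a) by rewrite mulrA divfK.
  by apply: subringM => //; apply: hk.
have [[j [js jk uj]]|nu] := pselect (exists j, [/\ (j < size s)%N, j != k & vunit (s`_j / s`_k)]).
  have j0 : s`_j != 0 by case: uj; rewrite mulf_eq0 negb_or => /andP[].
  have [jk'|kj|e] := ltngtP j k; last by rewrite e eqxx in jk.
    by exists j, k; rewrite jk' ks; split=> //; rewrite -invf_div; apply: vunitV.
  by exists k, j; rewrite kj js; split.
have : vmax (\sum_(i < size s | i != k :> nat) s`_i / s`_k).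
  elim/big_ind: _ => [|//|i ik]; [exact: vmax0|exact: vmaxD|].
  by split; [apply/hk/mem_nth | move=> u; apply: nu; exists i].
move: s0; rewrite (big_nth 0) big_mkord (bigD1 (Ordinal ks)) //= => /eqP.
rewrite addrC addr_eq0 -mulr_suml => /eqP.
rewrite (eq_bigl (fun i : 'I_(size s) => i != k :> nat)); last by move=> i.
move=> ->; rewrite mulNr divff // => -[_ []]; split; rewrite ?oppr_eq0 ?oner_eq0 //.
  by apply: subringN => //; apply: subring1.
by rewrite invrN1; apply: subringN => //; apply: subring1.
Qed.

End ValuationRing.

(** * The absolute value attached to the valuation ring *)

Section PadicAlgC.
Variables (R : realType) (p : nat) (pp : prime p) (B : set algC).
Hypotheses (ringB : is_subring B) (notVp : ~ B p%:R^-1).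
Hypothesis (valB : forall x, B x \/ B x^-1).
Local Notation vunit := (vunit B).
Let pC : algC := p%:R.

Let p0 : pC != 0. Proof. by rewrite pnatr_eq0 -lt0n prime_gt0. Qed.
Let Bp : B pC. Proof. exact: subring_nat. Qed.

Lemma vring_expz (n : int) : B (pC ^ n) -> (0 <= n)%R.
Proof.
case: n => // n h; exfalso; apply: notVp.
have -> : p%:R^-1 = pC ^+ n * pC ^ Negz n.
  by rewrite /exprz exprS invfM mulrCA divff ?expf_neq0 // mulr1.
by apply: subringM => //; apply: subringX.
Qed.

Lemma vunit_expz (n : int) : vunit (pC ^ n) -> n = 0.
Proof.
move=> [_ /vring_expz n0]; rewrite invr_expz => /vring_expz n0'.
by apply: le_anti; rewrite n0 -oppr_ge0 n0'.
Qed.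

(** Otherwise p and n both lie in the maximal ideal, and by Bezout so does 1. *)
Lemma vunit_coprime n : coprime p n -> vunit n%:R.
Proof.
move=> cpn; have n0 : (n%:R : algC) != 0.
  rewrite pnatr_eq0; apply: contraTneq cpn => ->.
  by rewrite /coprime gcdn0 neq_ltn prime_gt1 ?orbT.
apply: contrapT => nu.
have Bn : vmax B n%:R by split=> //; apply: subring_nat.
have Bmp : vmax B p%:R by split=> // -[].
have [u v e _] := @egcdnP p n (prime_gt0 pp).
rewrite (eqP cpn) in e.
have : vmax B 1.
  have -> : (1 : algC) = u%:R * p%:R + - v%:R * n%:R.
    by rewrite mulNr -!natrM e natrD addrAC subrr add0r.
  apply: vmaxD => //; apply: vmaxM => //; last apply: subringN => //; exact: subring_nat.
by case=> _ []; apply: vunit1.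
Qed.

(** Encodes that x has p-adic order r / s, by saying that x^s is a unit times p^r. Values are thus
    rational, and no abstract value group is formed. *)
Definition has_val (x : algC) (s : nat) (r : int) : Prop :=
  (0 < s)%N /\ vunit (x ^+ s * pC ^ (- r)).

Lemma pexpzX (a : int) (k : nat) : (pC ^ a) ^+ k = pC ^ (a * k).
Proof. exact: (exprz_exp pC a k). Qed.

Lemma has_val_nat n : (0 < n)%N -> has_val n%:R 1 (logn p n).
Proof.
move=> n0; split=> //; have [m cpm {1}->] := pfactor_coprime pp n0.
rewrite expr1 natrM natrX -mulrA -[pC]/(p%:R) -invr_expz divff ?expf_neq0 //.
by rewrite mulr1; apply: vunit_coprime.
Qed.

Lemma has_valM x y s r s' r' : has_val x s r -> has_val y s' r' ->
  has_val (x * y) (s * s') (r * s' + r' * s).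
Proof.
move=> [s0 u] [s0' u']; split; first by rewrite muln_gt0 s0.
have := vunitM ringB (vunitX ringB s' u) (vunitX ringB s u').
congr (vunit _); rewrite !exprMn -!exprM !pexpzX mulrACA [(s' * s)%N]mulnC.
by rewrite -expfzDr // !mulNr -opprD.
Qed.

Lemma has_valV x s r : has_val x s r -> has_val x^-1 s (- r).
Proof.
move=> [s0 u]; split=> //; have := vunitV u.
by congr (vunit _); rewrite invfM exprVn invr_expz.
Qed.

Lemma has_val_neq0 x s r : has_val x s r -> x != 0.
Proof.
move=> [s0 [+ _ _]]; apply: contraNneq => ->.
by rewrite expr0n eqn0Ngt s0 mul0r.
Qed.

Lemma has_val_unique x s r s' r' : has_val x s r -> has_val x s' r' ->
  r * s' = r' * s.
Proof.
move=> h /has_valV h'; have := has_valM h h'; rewrite divff ?(has_val_neq0 h) //.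
move=> [_]; rewrite expr1n mul1r => /vunit_expz/eqP; rewrite oppr_eq0 mulNr subr_eq0.
by move=> /eqP.
Qed.

Lemma has_val_rat (q : rat) : q != 0 ->
  has_val (ratr q) 1 ((logn p `|numq q|)%:Z - (logn p `|denq q|)%:Z).
Proof.
move=> q0; rewrite -[q in ratr q]divq_num_den.
have num0 : (0 < `|numq q|)%N by rewrite absz_gt0 numq_eq0.
have den0 : (0 < `|denq q|)%N by rewrite absz_gt0 denq_neq0.
have := has_valM (has_val_nat num0) (has_valV (has_val_nat den0)).
rewrite !mulr1 /has_val => -[_ u]; split=> //; move: u.
rewrite !expr1 fmorph_div /= !ratr_int.
have -> : (denq q)%:~R = `|denq q|%N%:R :> algC.
  by rewrite natr_absz gtr0_norm ?denq_gt0.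
have [->|->] // : `|numq q|%N%:R = (numq q)%:~R :> algC \/
    `|numq q|%N%:R = - (numq q)%:~R :> algC.
  rewrite natr_absz; have [h|h] := leP 0 (numq q); first by left; rewrite ger0_norm.
  by right; rewrite ltr0_norm // mulrNz.
rewrite !mulNr => -[u0 Bu Bu']; rewrite oppr_eq0 in u0.
split=> //; first by rewrite -[X in B X]opprK; apply: subringN.
by rewrite -[X in B X]opprK; apply: subringN => //; rewrite -invrN.
Qed.

(** In the equation given by the minimal polynomial, two nonzero terms c_i x^i and c_j x^j with i <
    j have a unit as ratio. Hence x^(j - i) is a unit times the rational c_i / c_j, whose order is
    known. *)
Lemma has_val_exists x : x != 0 -> exists s r, has_val x s r.
Proof.
move=> x0; have [q Dq] := minCpoly_rat x.
pose n := size (minCpoly x).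
pose t := [seq (minCpoly x)`_i * x ^+ i | i <- iota 0 n].
have t0 : \sum_(y <- t) y = 0.
  rewrite big_map -[RHS](eqP (root_minCpoly x)) horner_coef -/n.
  by rewrite -(big_mkord xpredT (fun i => (minCpoly x)`_i * x ^+ i)) /index_iota subn0.
have n0 : (0 < n)%N by apply: leq_trans (size_minCpoly x).
have ht : has (fun y => y != 0) t.
  apply/hasP; exists ((minCpoly x)`_n.-1 * x ^+ n.-1).
    by apply/mapP; exists n.-1; rewrite ?mem_iota //= add0n prednK.
  by rewrite -lead_coefE (monicP (minCpoly_monic x)) mul1r expf_neq0.
have [i [j [/andP[ij js] i0]]] := vunit_ratio ringB valB t0 ht.
have it := ltn_trans ij js; rewrite size_map size_iota in it js.
move: i0; rewrite !(nth_map 0%N) ?size_iota // !nth_iota // !add0n Dq !coef_map /=.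
rewrite mulf_eq0 negb_or => /andP[qi0 xi0] u.
have qj0 : ratr q`_j != 0 :> algC.
  have [+ _ _] := u; rewrite mulf_eq0 negb_or => /andP[+ _].
  by rewrite mulf_eq0 negb_or => /andP[].
pose q1 := q`_j / q`_i.
have q10 : q1 != 0.
  by move: qi0 qj0; rewrite !fmorph_eq0 => qi0 qj0; rewrite mulf_neq0 ?invr_eq0.
have [_ u1] := has_val_rat q10; set e := (_ - _) in u1.
exists (j - i)%N, (- e); split; first by rewrite subn_gt0.
have := vunitM ringB u (vunitV u1); congr (vunit _).
rewrite expr1 [(ratr q1 * _)^-1]invfM invr_expz !opprK /q1 fmorph_div /= expfB //.
move: (ratr q`_i) (ratr q`_j) (x ^+ i) (x ^+ j) (pC ^ e) qi0 qj0 xi0.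
by move=> a b c d f a0 b0 c0; field; rewrite a0 b0 c0.
Qed.

(** p^(- r / s) for any admissible pair; [has_val_unique] makes the choice harmless, and
    [has_val_exists] keeps the default from occurring when x is nonzero. *)
Definition padic_abs (x : algC) : R :=
  if x == 0 then 0 else
  let sr := xget (1%N, 0) [set sr | has_val x sr.1 sr.2]%classic in
  expR (- (sr.2%:~R / sr.1%:R) * ln p%:R).

Lemma padic_absE x s r : has_val x s r ->
  padic_abs x = expR (- (r%:~R / s%:R) * ln p%:R).
Proof.
move=> h; rewrite /padic_abs (negPf (has_val_neq0 h)).
case: xgetP => [[s' r'] _ /= h'|/(_ (s, r))[]//].
suff -> : r'%:~R / s'%:R = r%:~R / s%:R :> R by [].
have e := has_val_unique h h'.
have [s0 _] := h; have [s0' _] := h'.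
have := congr1 (fun z : int => z%:~R : R) e; rewrite !intrM => {}e.
by apply/eqP; rewrite eqr_div ?pnatr_eq0 -?lt0n // e.
Qed.

Lemma padic_abs_le1 x : (padic_abs x <= 1) <-> B x.
Proof.
have [->|x0] := eqVneq x 0.
  by rewrite /padic_abs eqxx ler01; split=> // _; apply: subring0.
have [s [r h]] := has_val_exists x0; rewrite (padic_absE h).
have lnp : 0 < ln (p%:R : R) by rewrite ln_gt0 // ltr1n prime_gt1.
have [s0 [u0 Bu Bu']] := h.
have -> : (expR (- (r%:~R / s%:R) * ln (p%:R : R)) <= 1) = (0 <= r).
  rewrite -[X in _ <= X]expR0 ler_expR mulNr oppr_le0 pmulr_lge0 //.
  by rewrite pmulr_lge0 ?invr_gt0 ?ltr0n // ler0z.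
split=> [r0|Bx].
  apply: (vring_root ringB valB s0).
  have -> : x ^+ s = x ^+ s * pC ^ (- r) * pC ^ r.
    by rewrite -mulrA -expfzDr // addNr mulr1.
  apply: subringM => //; case: (r) r0 => // n _; exact: subringX.
apply: vring_expz.
have -> : pC ^ r = (x ^+ s * pC ^ (- r))^-1 * x ^+ s.
  by rewrite invfM invr_expz opprK mulrAC mulVf ?mul1r // expf_neq0.
by apply: subringM => //; apply: subringX.
Qed.

Lemma padic_abs_ge0 x : 0 <= padic_abs x.
Proof. by rewrite /padic_abs; case: ifP => // _; apply: expR_ge0. Qed.

Lemma padic_abs_eq0 x : padic_abs x = 0 <-> x = 0.
Proof.
split=> [|->]; last by rewrite /padic_abs eqxx.
by rewrite /padic_abs; case: eqP => // _ /eqP; rewrite gt_eqF // expR_gt0.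
Qed.

Lemma padic_absM x y : padic_abs (x * y) = padic_abs x * padic_abs y.
Proof.
have [->|x0] := eqVneq x 0; first by rewrite mul0r (iffRL (padic_abs_eq0 0)) // mul0r.
have [->|y0] := eqVneq y 0; first by rewrite mulr0 (iffRL (padic_abs_eq0 0)) // mulr0.
have [s [r h]] := has_val_exists x0; have [s' [r' h']] := has_val_exists y0.
rewrite (padic_absE (has_valM h h')) (padic_absE h) (padic_absE h') -expRD.
congr (expR _); rewrite intrD !intrM natrM.
have [s0 _] := h; have [s0' _] := h'.
have sn : s%:R != 0 :> R by rewrite pnatr_eq0 -lt0n.
have sn' : s'%:R != 0 :> R by rewrite pnatr_eq0 -lt0n.
by rewrite -!pmulrn; field; rewrite sn sn'.
Qed.

(** B is the closed unit ball, so for |x| <= |y| with y nonzero the element x / y + 1 stays in B. *)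
Lemma padic_abs_ultra x y : padic_abs (x + y) <= Num.max (padic_abs x) (padic_abs y).
Proof.
wlog yx : x y / padic_abs x <= padic_abs y.
  move=> W; have [h|/ltW h] := leP (padic_abs x) (padic_abs y).
    by rewrite -(max_idPr h); apply: W.
  by rewrite -(max_idPl h) maxC addrC; apply: W.
have [y0|y0] := eqVneq y 0.
  by rewrite y0 addr0 le_max lexx.
have py : 0 < padic_abs y.
  by rewrite lt_def padic_abs_ge0 andbT; apply: contraNneq y0 => /padic_abs_eq0 ->.
have Bxy : B (x / y).
  by apply/padic_abs_le1; rewrite -(ler_pM2r py) -padic_absM divfK // mul1r.
rewrite le_max; apply/orP; right.
have -> : x + y = (x / y + 1) * y by rewrite mulrDl divfK // mul1r.
rewrite padic_absM ler_piMl // ?padic_abs_ge0 //; apply/padic_abs_le1.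
by apply: subringD => //; apply: subring1.
Qed.

Lemma padic_abs_absolute_value : absolute_value padic_abs.
Proof.
split; [exact: padic_abs_ge0|exact: padic_abs_eq0|exact: padic_absM|].
move=> x y; apply: le_trans (padic_abs_ultra x y) _.
by rewrite ge_max lerDl lerDr !padic_abs_ge0.
Qed.

Lemma padic_abs_rat q : padic_abs (ratr q) = rat_abs R (RatFinite pp) q.
Proof.
rewrite /rat_abs; case: eqVneq => [->|q0]; first by rewrite rmorph0; apply/padic_abs_eq0.
rewrite (padic_absE (has_val_rat q0)) divr1 -intrN opprB.
have pR : 0 < (p%:R : R) by rewrite ltr0n prime_gt0.
by rewrite -powR_intmul ?ltW // /powR gt_eqF.
Qed.

End PadicAlgC.

Lemma padic_absolute_value_exists (R : realType) (p : nat) (pp : prime p) :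
  exists A : algC -> R, [/\ absolute_value A,
    forall x y, A (x + y) <= Num.max (A x) (A y) &
    forall q : rat, A (ratr q) = rat_abs R (RatFinite pp) q].
Proof.
have [||B [rB nB vB]] := @valuation_ring_exists algC p.
- by rewrite pnatr_eq0 -lt0n prime_gt0.
- move=> n; rewrite -[p%:R]/(p%:Z%:~R) -intrM -[1]/(1%:~R) eqr_int.
  apply/eqP => /(congr1 absz); rewrite abszM /= => /eqP.
  by rewrite muln_eq1 => /andP[_ /eqP p1]; rewrite p1 in pp.
exists (padic_abs R p B); split.
- exact: padic_abs_absolute_value.
- exact: padic_abs_ultra.
- exact: padic_abs_rat.
Qed.

(** * The Mahler measure of the minimal polynomial *)

Definition local_mahler (R : realType) (A : algC -> R) (x : algC) : R :=
  \prod_(r <- conjs x) Num.max 1 (A r).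

Lemma primitive_minpoly_exists (x : algC) : exists q : {poly int},
  [/\ 0 < lead_coef q, zcontents q = 1 &
      map_poly intr q = (lead_coef q)%:~R *: minCpoly x].
Proof.
have [p Dp] := minCpoly_rat x.
have [q [a a0 Dq]] := rat_poly_scale p.
have p0 : p != 0.
  by apply/eqP => p0; have := minCpoly_eq0 x; rewrite Dp p0 map_poly0 eqxx.
have q0 : q != 0 by apply: contraNneq p0 => q0; rewrite Dq q0 map_poly0 scaler0.
pose z := zprimitive q.
have cz : zcontents z = 1 by rewrite zcontents_primitive q0.
have lz : 0 < lead_coef z by rewrite -sgz_gt0 -sgz_contents cz.
exists z; split=> //.
have [c c0 Dc] : exists2 c : algC, c != 0 & minCpoly x = c *: map_poly intr z.
  exists (ratr (a%:~R^-1 * (zcontents q)%:~R)).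
    by rewrite fmorph_eq0 mulf_neq0 ?invr_eq0 ?intr_eq0 // zcontents_eq0.
  have Dq' : map_poly intr q = (zcontents q)%:~R *: map_poly intr z :> {poly rat}.
    by rewrite [q in LHS]zpolyEprim map_polyZ.
  rewrite Dp Dq Dq' scalerA map_polyZ /=; congr (_ *: _).
  by rewrite -map_poly_comp; apply: eq_map_poly => n /=; rewrite ratr_int.
have lc : lead_coef (map_poly intr z) = (lead_coef z)%:~R :> algC.
  by rewrite lead_coef_map_inj //; apply: intr_inj.
have : lead_coef (minCpoly x) = c * (lead_coef z)%:~R by rewrite Dc lead_coefZ lc.
rewrite (monicP (minCpoly_monic x)) => /esym e.
by rewrite Dc scalerA mulrC e scale1r.
Qed.

Definition int_minpoly (x : algC) : {poly int} := projT1 (cid (primitive_minpoly_exists x)).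

Definition minpoly_lead (x : algC) : nat := `|lead_coef (int_minpoly x)|%N.

Lemma int_minpolyP x : [/\ (0 < minpoly_lead x)%N, zcontents (int_minpoly x) = 1 &
  map_poly intr (int_minpoly x) = (minpoly_lead x)%:R *: minCpoly x].
Proof.
rewrite /minpoly_lead /int_minpoly; case: cid => q /= [l0 c1 e]; split=> //.
  by rewrite absz_gt0 gt_eqF.
by rewrite e natr_absz gtr0_norm.
Qed.

(** * Gauss's lemma at a prime *)

Section Gauss.
Variables (R : realType) (p : nat) (pp : prime p) (A : algC -> R).
Hypotheses (absA : absolute_value A)
  (ultraA : forall x y, A (x + y) <= Num.max (A x) (A y))
  (AE : forall q : rat, A (ratr q) = rat_abs R (RatFinite pp) q).

Definition gauss_norm (g : {poly algC}) (G : R) : Prop :=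
  (forall i, A g`_i <= G) /\ exists i, A g`_i = G.

Lemma gauss_norm_unique g G H : gauss_norm g G -> gauss_norm g H -> G = H.
Proof.
move=> [hG [i Gi]] [hH [j Hj]]; apply: le_anti.
by rewrite -{1}Gi hH -Hj hG.
Qed.

Lemma ultra_dominant x y : A y < A x -> A (x - y) = A x.
Proof.
move=> yx; apply: le_anti; apply/andP; split.
  by apply: le_trans (ultraA _ _) _; rewrite (absvN absA) ge_max lexx ltW.
have := ultraA (x - y) y; rewrite subrK le_max => /orP[//|].
by rewrite leNgt yx.
Qed.

(** The upper bound is the ultrametric inequality. To attain it, a coefficient g_(j-1) - r g_j with
    one dominant term is needed: for |r| <= 1 take j - 1 the last index at which |g_j| is maximal,
    for |r| > 1 take j any such index. *)
Lemma gauss_norm_XsubC r g G : 0 < G -> gauss_norm g G ->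
  gauss_norm (('X - r%:P) * g) (Num.max 1 (A r) * G).
Proof.
move=> G0 [hG [i Gi]].
have cE j : (('X - r%:P) * g)`_j = (if j == 0%N then 0 else g`_j.-1) - r * g`_j.
  by rewrite mulrBl coefB coefXM coefCM.
have c1 j : A (if j == 0%N then 0 else g`_j.-1) <= G.
  by case: ifP => _ //; rewrite absv0 // ltW.
split.
  move=> j; rewrite cE; apply: le_trans (ultraA _ _) _; rewrite (absvN absA) ge_max.
  apply/andP; split.
    by apply: le_trans (c1 j) _; rewrite ler_peMl ?(ltW G0) // le_max lexx.
  rewrite (absvM absA) ler_pM ?(absv_ge0 absA) //.
  by rewrite le_max lexx orbT.
have [r1|r1] := leP (A r) 1.
  have bound n : A g`_n == G -> (n <= size g)%N.
    move=> /eqP Gn; rewrite leqNgt; apply/negP => /ltnW ns.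
    by move: G0; rewrite -Gn nth_default // absv0 // ltxx.
  have ex : exists n, A g`_n == G by exists i; rewrite Gi.
  pose n := ex_maxn ex bound.
  have [Gn maxn] : A g`_n = G /\ forall k, A g`_k == G -> (k <= n)%N.
    by rewrite /n; case: ex_maxnP => k /eqP.
  exists n.+1; rewrite cE /= mul1r -Gn; apply: ultra_dominant.
  rewrite (absvM absA) Gn; apply: le_lt_trans (_ : A g`_n.+1 < G).
    by rewrite ler_piMl ?absv_ge0.
  rewrite lt_neqAle hG andbT; apply/negP => /maxn; by rewrite ltnn.
exists i; rewrite cE -(absvN absA) opprB -Gi -(absvM absA).
rewrite ultra_dominant // (absvM absA) Gi (le_lt_trans (c1 i)) //.
by rewrite ltr_pMl.
Qed.

Lemma gauss_norm_prod (s : seq algC) :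
  gauss_norm (\prod_(r <- s) ('X - r%:P)) (\prod_(r <- s) Num.max 1 (A r)).
Proof.
elim: s => [|r s IH].
  rewrite !big_nil; split=> [i|]; last by exists 0%N; rewrite coef1 absv1.
  by rewrite coef1; case: (i == 0%N); rewrite ?absv1 ?absv0.
rewrite !big_cons; apply: gauss_norm_XsubC => //.
by apply: prodr_gt0 => i _; rewrite lt_max ltr01.
Qed.

Lemma gauss_normZ a g G : gauss_norm g G -> gauss_norm (a *: g) (A a * G).
Proof.
move=> [hG [i Gi]]; split=> [j|]; last by exists i; rewrite coefZ absvM // Gi.
by rewrite coefZ absvM // ler_wpM2l ?absv_ge0.
Qed.

Lemma padic_abs_nat n : (0 < n)%N -> A n%:R = (p%:R ^+ logn p n)^-1.
Proof.
move=> n0; rewrite -(ratr_nat algC) AE /rat_abs pnatr_eq0 eqn0Ngt n0 /=.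
by rewrite (numq_int n) (denq_int n) /= logn1 sub0r -exprnN.
Qed.

Lemma padic_abs_nat_le1 n : A n%:R <= 1.
Proof.
have [->|n0] := posnP n; first by rewrite absv0.
rewrite padic_abs_nat // invf_le1 ?exprn_ege1 // ?exprn_gt0 ?ltr0n ?prime_gt0 //.
by rewrite ler1n prime_gt0.
Qed.

Lemma gauss_norm_primitive (q : {poly int}) : zcontents q = 1 ->
  gauss_norm (map_poly intr q) 1.
Proof.
move=> c1.
have absint (n : int) : A n%:~R = A `|n|%N%:R.
  by case: n => n //=; rewrite NegzE mulrNz absvN.
split=> [i|]; first by rewrite coef_map absint padic_abs_nat_le1.
have [i hi] : exists i, ~~ (p%:Z %| q`_i)%Z.
  apply: contrapT => /forallNP h.
  have : (p%:Z %| zcontents q)%Z.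
    by rewrite dvdz_contents; apply/polyOverP => i; apply/negPn/negP/h.
  by rewrite c1 dvdz1 /= gtn_eqF // prime_gt1.
exists i; rewrite coef_map /= absint.
have qi0 : (0 < absz (q`_i)%R)%N.
  by rewrite absz_gt0; apply: contraNneq hi => ->; rewrite dvdz0.
rewrite padic_abs_nat //; move: hi; rewrite dvdzE /= => hi.
have -> : logn p (absz q`_i) = 0%N.
  by apply/eqP; rewrite -leqn0 leqNgt logn_gt0 mem_primes pp qi0 hi.
by rewrite expr0 invr1.
Qed.

(** The primitive integral polynomial has Gauss norm 1, and that norm is also |a|_p times the
    product over the conjugates, a being the leading coefficient. In particular the product depends
    on A only through p. *)
Lemma local_mahler_padic x :
  local_mahler A x = p%:R ^+ logn p (minpoly_lead x).
Proof.
have [l0 c1 e] := int_minpolyP x.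
have := gauss_norm_primitive c1; rewrite e minCpolyE => h.
have := gauss_norm_unique h (gauss_normZ (minpoly_lead x)%:R (gauss_norm_prod (conjs x))).
rewrite -/(local_mahler A x) padic_abs_nat // => /esym/(canRL (mulKf _)) -> //.
  by rewrite mulr1 invrK.
by rewrite invr_eq0 expf_neq0 // pnatr_eq0 -lt0n prime_gt0.
Qed.

End Gauss.

Lemma normc_absolute_value (R : realType) (iota : {rmorphism algC -> R[i]}) :
  absolute_value (fun x => Normc.normc (iota x)).
Proof.
split=> [x|x|x y|x y].
- by case: (iota x) => a b; apply: sqrtr_ge0.
- split=> [/Normc.eq0_normc/eqP|->]; last by rewrite rmorph0 Normc.normc0.
  by rewrite fmorph_eq0 => /eqP.
- by rewrite rmorphM Normc.normcM.
- by rewrite rmorphD; apply: le_normcD.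
Qed.

Lemma normc_rat (R : realType) (iota : {rmorphism algC -> R[i]}) (q : rat) :
  Normc.normc (iota (ratr q)) = rat_abs R RatInfinite q.
Proof.
rewrite fmorph_rat -(fmorph_rat (real_complex R)) /= expr0n addr0 sqrtr_sqr //.
Qed.

(** Applied with d the local and n the global degree: raising the height to the power [Q(x) : Q]
    clears the denominators in the normalized absolute values. *)
Lemma max1_powR_ratio (R : realType) (t : R) (d n : nat) : 0 <= t -> (0 < n)%N ->
  Num.max 1 (t `^ (d%:R / n%:R)) ^+ n = Num.max 1 t ^+ d.
Proof.
move=> t0 n0; have n0' : (n%:R : R) != 0 by rewrite pnatr_eq0 -lt0n.
have e0 : 0 <= d%:R / n%:R :> R by rewrite divr_ge0.
have [t1|t1] := leP t 1.
  have : t `^ (d%:R / n%:R) <= 1 `^ (d%:R / n%:R) by rewrite ge0_ler_powR // nnegrE.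
  by rewrite powR1 => h; rewrite (max_idPl h) !expr1n.
have : 1 `^ (d%:R / n%:R) <= t `^ (d%:R / n%:R).
  by rewrite ge0_ler_powR // ?nnegrE // ltW.
rewrite powR1 => h; rewrite (max_idPr h).
by rewrite -powR_mulrn ?powR_ge0 // -powRrM divfK // powR_mulrn.
Qed.

(** * Regrouping the height by rational places *)

Section LocalProduct.
Variables (R : realType) (w : rat_place) (A : algC -> R).
Hypotheses (absA : absolute_value A) (AE : forall q : rat, A (ratr q) = rat_abs R w q).
Variables (F : fieldExtType rat) (FC : {rmorphism F -> algC}) (x0 : F).
Hypothesis gen : <<1; x0>>%VS = fullv.

Definition place_seq : seq (F -> R) :=
  undup [seq (A \o embed FC x0 r : F -> R) | r <- conjs (FC x0)].

Lemma mem_place_seq v : (v \in place_seq) <-> place_over w v.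
Proof.
rewrite mem_undup; split=> [/mapP[r rx ->]|/(place_embed absA AE FC gen)[r rx ->]].
  exact: embed_place.
exact: map_f.
Qed.

(** In the list of A \o embed r over all conjugates r, a place v occurs as often as its local
    degree, so the local degrees turn into multiplicities. *)
Lemma place_prod : \prod_(v <- place_seq) Num.max 1 (place_norm v x0) ^+ \dim {: F} =
  local_mahler A (FC x0).
Proof.
pose f (v : F -> R) := Num.max 1 (v x0).
transitivity (\prod_(v <- [seq (A \o embed FC x0 r : F -> R) | r <- conjs (FC x0)]) f v).
  rewrite -[RHS]prodr_undup_exp_count [LHS]big_seq [RHS]big_seq; apply: eq_bigr => v.
  rewrite mem_undup => /mapP[r rx ->]; rewrite /place_norm max1_powR_ratio ?adim_gt0 //.
    rewrite (local_degree_embed absA AE gen rx) /same_place size_filter.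
    by rewrite count_map; congr (_ ^+ _); apply: eq_count.
  exact: (absv_ge0 absA).
rewrite big_map /local_mahler big_seq [RHS]big_seq; apply: eq_bigr => r rx.
by rewrite /f /= -[conj_aut _ _ _]/(embed FC x0 r x0) embed_gen.
Qed.

End LocalProduct.

Lemma Qadj_spec (x : algC) : exists2 FC : {rmorphism Qadj x -> algC},
  FC (Qadj_gen x) = x & <<1; Qadj_gen x>>%VS = fullv.
Proof.
rewrite /Qadj_gen /Qadj; case: num_field_exists => Qs [QsC [s1 /= Ds gs]].
case: s1 Ds gs => [//|y [|//]] [Dy] gy; exists QsC => //=.
by rewrite -gy span_seq1.
Qed.

Section Formula.
Variables (R : realType) (iota : {rmorphism algC -> R[i]}).

Definition arch_abs (x : algC) : R := Normc.normc (iota x).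

Definition place_abs (w : rat_place) : algC -> R :=
  match w with
  | RatInfinite => arch_abs
  | RatFinite p pp => projT1 (cid (padic_absolute_value_exists R pp))
  end.

Lemma place_abs_absolute_value w : absolute_value (place_abs w).
Proof.
case: w => [|p pp] /=; first exact: normc_absolute_value.
by case: cid => A [].
Qed.

Lemma place_abs_rat w q : place_abs w (ratr q) = rat_abs R w q.
Proof.
case: w => [|p pp]; first exact: normc_rat.
by rewrite /place_abs; case: cid => A [].
Qed.

Lemma local_mahler_place p (pp : prime p) x :
  local_mahler (place_abs (RatFinite pp)) x = p%:R ^+ logn p (minpoly_lead x).
Proof.
rewrite /place_abs; case: cid => A [absA ultA AE].
exact: (local_mahler_padic absA ultA AE).
Qed.

(* 0, not being prime, encodes the infinite place. *)
Definition place_of (p : nat) : rat_place :=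
  if @idP (prime p) is ReflectT pp then RatFinite pp else RatInfinite.

Lemma place_of_prime p (pp : prime p) : place_of p = RatFinite pp.
Proof.
rewrite /place_of; case: {-}_ / idP => [pp'|/(_ pp)//].
by rewrite (bool_irrelevance pp' pp).
Qed.

Lemma place_of0 : place_of 0 = RatInfinite.
Proof. by rewrite /place_of; case: {-}_ / idP. Qed.

Lemma rat_abs_nat w (n : nat) : (0 < n)%N -> rat_abs R w n%:R =
  if w is RatFinite p _ then (p%:R ^+ logn p n)^-1 else n%:R.
Proof.
case: w => [|p pp] n0 /=; first by rewrite ratr_nat ger0_norm.
by rewrite pnatr_eq0 eqn0Ngt n0 (numq_int n) (denq_int n) /= logn1 sub0r -exprnN.
Qed.

(** The prime p is itself the test element: only the p-adic absolute value makes it smaller than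
    1. *)
Lemma place_of_inj p q : (p == 0%N) || prime p -> (q == 0%N) || prime q ->
  rat_abs R (place_of p) = rat_abs R (place_of q) -> p = q.
Proof.
wlog pp : p q / prime p.
  move=> W hp hq e; case/orP: (hp) => [/eqP p0|pp]; last exact: W.
  case/orP: (hq) => [/eqP q0|qq]; first by rewrite p0 q0.
  by apply/esym/W.
move=> _ hq; rewrite (place_of_prime pp) => /(congr1 (fun f => f p%:R)).
have p0 := prime_gt0 pp; have p1 := prime_gt1 pp.
rewrite !rat_abs_nat // logn_prime // eqxx expr1.
have pV : (p%:R : R)^-1 < 1 by rewrite invf_lt1 ?ltr0n ?ltr1n.
case/orP: hq => [/eqP ->|qq].
  by rewrite place_of0 => e; move: pV; rewrite e ltrn1 ltnNge p0.
rewrite (place_of_prime qq) logn_prime //; case: eqP => // _.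
by rewrite expr0 invr1 => e; move: pV; rewrite e ltxx.
Qed.

Lemma place_abs_ge0 w y : 0 <= place_abs w y.
Proof. exact/absv_ge0/place_abs_absolute_value. Qed.

Lemma local_mahler_ge1 (A : algC -> R) x : 1 <= local_mahler A x.
Proof.
rewrite /local_mahler; elim/big_ind: _ => // [a b a1 b1|r _].
  by rewrite -[1]mulr1 ler_pM.
by rewrite le_max lexx.
Qed.

Lemma local_mahler_eq1 (A : algC -> R) x r :
  local_mahler A x = 1 -> r \in conjs x -> A r <= 1.
Proof.
rewrite /local_mahler => e rx; move: e; rewrite (big_rem r) //=.
set c := \prod_(_ <- _) _ => e; rewrite leNgt; apply/negP => r1.
have c1 : 1 <= c.
  rewrite /c; elim/big_ind: _ => // [a b a1 b1|s _].
    by rewrite -[1]mulr1 ler_pM.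
  by rewrite le_max lexx.
move: e; rewrite (max_idPr _) ?ltW // => e.
by have := ler_peMr (ltW (lt_trans ltr01 r1)) c1; rewrite e leNgt r1.
Qed.

Lemma uniq_flatten_map (T I : eqType) (f : I -> seq T) (s : seq I) :
  uniq s -> (forall i, i \in s -> uniq (f i)) ->
  (forall i j y, i \in s -> j \in s -> y \in f i -> y \in f j -> i = j) ->
  uniq (flatten (map f s)).
Proof.
elim: s => [//|i s IH] /= /andP[is_ us] uf inj.
rewrite cat_uniq uf ?mem_head // IH //=; last 2 first.
- by move=> j js; apply: uf; rewrite inE js orbT.
- by move=> j k y js ks; apply: inj; rewrite inE ?js ?ks orbT.
rewrite andbT; apply/hasPn => y /flatten_mapP[j js yj]; apply/negP => yi.
by case/negP: is_; rewrite (inj i j y) // ?mem_head // inE js orbT.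
Qed.

(** Places outside infinity and the primes dividing the leading coefficient a contribute 1. The
    finite places that remain contribute the prime powers in the factorization of a. *)
Lemma mahler_formula x :
  mahler R x = (minpoly_lead x)%:R * local_mahler arch_abs x.
Proof.
have [FC Dx gen] := Qadj_spec x.
set x0 := Qadj_gen x in Dx gen *; set a := minpoly_lead x.
have a0 : (0 < a)%N by have [] := int_minpolyP x.
pose W := 0%N :: primes a.
have WP p : p \in W -> (p == 0%N) || prime p.
  by rewrite inE mem_primes => /orP[->|/and3P[->]] //; rewrite orbT.
pose V p := place_seq (place_abs (place_of p)) FC x0.
have VP p v : v \in V p <-> place_over (place_of p) v.
  apply: mem_place_seq => //; first exact: place_abs_absolute_value.
  exact: place_abs_rat.
have uV : uniq (flatten (map V W)).
  apply: uniq_flatten_map.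
  - by rewrite /= primes_uniq andbT mem_primes.
  - by move=> p _; apply: undup_uniq.
  - move=> p q v pW qW /VP[_ vp] /VP[_ vq].
    apply: place_of_inj; rewrite ?WP //; apply/funext => t.
    by rewrite -vp -vq.
rewrite /mahler /weil_height /field_height.
have -> : \big[*%R/1]_(v \in @places R (Qadj x)) Num.max 1 (place_norm v x0) =
    \prod_(v <- flatten (map V W)) Num.max 1 (place_norm v x0).
  rewrite (fsbigE (flatten (map V W))) //.
  - rewrite big_seq_cond [RHS]big_seq; apply: eq_bigl => v.
    apply: andb_idr => /flatten_mapP[p pW /VP vp].
    by apply/mem_set; exists (place_of p).
  - move=> v vr; have /flatten_mapP[p pW /VP vp] : v \in flatten (map V W) := vr.
    by exists (place_of p).
  (* At a prime not dividing a the local product is 1, which forces every conjugate, hence every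
     place over that prime, to be at most 1. *)
  move=> v [w vw] nv.
  have : w <> RatInfinite.
    move=> w0; case/negP: nv; apply/flatten_mapP; exists 0%N; first exact: mem_head.
    by apply/VP; rewrite place_of0 -w0.
  case: w vw => // p pp vw _.
  have pa : p \notin primes a.
    apply: contra nv => pa; apply/flatten_mapP; exists p; first by rewrite inE pa orbT.
    by apply/VP; rewrite (place_of_prime pp).
  have l1 : local_mahler (place_abs (RatFinite pp)) x = 1.
    rewrite local_mahler_place; have -> : logn p a = 0%N; last by rewrite expr0.
    by apply/eqP; rewrite -leqn0 leqNgt logn_gt0.
  have [r rx ->] := place_embed (place_abs_absolute_value (RatFinite pp))
    (place_abs_rat (RatFinite pp)) FC gen vw.
  rewrite -{}Dx in l1; apply/max_idPl; rewrite /place_norm /=.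
  set e := _ / _.
  have : place_abs (RatFinite pp) (embed FC x0 r x0) `^ e <= 1 `^ e.
    rewrite ge0_ler_powR ?nnegrE ?ler01 ?place_abs_ge0 ?divr_ge0 //.
    by rewrite embed_gen // (local_mahler_eq1 l1).
  by rewrite powR1.
rewrite big_flatten big_map -prodrXl.
transitivity (\prod_(p <- W) local_mahler (place_abs (place_of p)) x).
  apply: eq_bigr => p _; rewrite -prodrXl -[x in RHS]Dx.
  apply: place_prod => //; first exact: place_abs_absolute_value.
  exact: place_abs_rat.
rewrite big_cons place_of0 mulrC; congr (_ * _).
rewrite {2}[a](prod_prime_decomp a0) prime_decompE big_map natr_prod.
rewrite big_seq [RHS]big_seq; apply: eq_bigr => p.
rewrite mem_primes => /andP[pp _].
by rewrite (place_of_prime pp) local_mahler_place natrX.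
Qed.

End Formula.

(** * Comparison of Mahler measures *)

Section Comparison.
Variables (R : realType) (iota : {rmorphism algC -> R[i]}).

(** The p-adic hypotheses give divisibility of the leading coefficients, prime by prime; the
    archimedean one compares the remaining factors. *)
Lemma mahler_le x y :
  (forall A : algC -> R, absolute_value A -> local_mahler A x <= local_mahler A y) ->
  mahler R x <= mahler R y.
Proof.
move=> le_xy; rewrite !(mahler_formula iota).
have [lx _ _] := int_minpolyP x; have [ly _ _] := int_minpolyP y.
apply: ler_pM => //; first exact: le_trans (local_mahler_ge1 _ _).
  rewrite ler_nat; apply: dvdn_leq => //.
  apply/dvdn_partP => // p; rewrite mem_primes => /andP[pp _].
  rewrite p_part pfactor_dvdn //.
  have := le_xy _ (place_abs_absolute_value iota (RatFinite pp)).
  by rewrite !local_mahler_place ler_eXn2l // ltr1n prime_gt1.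
apply: le_xy; exact: normc_absolute_value.
Qed.

Lemma local_mahler1 (A : algC -> R) : absolute_value A -> local_mahler A 1 = 1.
Proof.
move=> absA; rewrite /local_mahler big_seq big1 // => r /conjs_autP[nu <-].
by rewrite rmorph1 absv1 // maxxx.
Qed.

Lemma ler_prod_subset (T : eqType) (f : T -> R) (s t : seq T) :
  uniq s -> uniq t -> {subset s <= t} -> (forall x, 1 <= f x) ->
  \prod_(x <- s) f x <= \prod_(x <- t) f x.
Proof.
move=> us ut st f1.
have e : perm_eq t (s ++ [seq x <- t | x \notin s]).
  apply: uniq_perm => //.
    rewrite cat_uniq us filter_uniq // andbT /=; apply/hasPn => x.
    by rewrite mem_filter => /andP[].
  by move=> x; rewrite mem_cat mem_filter; have [/st ->|] := boolP (x \in s).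
have f0 x : 0 <= f x by apply: le_trans (f1 x).
rewrite (perm_big _ e) big_cat /= ler_peMr ?prodr_ge0 //.
elim/big_ind: _ => // a b a1 b1; by rewrite -[1]mulr1 ler_pM.
Qed.

Lemma max1_prod (A : algC -> R) (s : seq algC) : absolute_value A ->
  Num.max 1 (A (\prod_(r <- s) r)) <= \prod_(r <- s) Num.max 1 (A r).
Proof.
move=> absA; elim: s => [|r s IH]; first by rewrite !big_nil absv1 // maxxx.
rewrite !big_cons (absvM absA).
have m1 (t : R) : 1 <= Num.max 1 t by rewrite le_max lexx.
have mt (t : R) : t <= Num.max 1 t by rewrite le_max lexx orbT.
have s1 : 1 <= \prod_(r <- s) Num.max 1 (A r) by apply: le_trans IH; apply: m1.
rewrite ge_max; apply/andP; split; first by rewrite mulr_ege1.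
by rewrite ler_pM ?absv_ge0 //; apply: le_trans IH; apply: mt.
Qed.

(** Raising to the power d maps the conjugates of x to conjugates of y, each being hit at most d
    times because X^d - t has at most d roots. All factors are at least 1, so the d-th powers of the
    two products compare. *)
Lemma local_mahler_root (A : algC -> R) (x y : algC) (d : nat) :
  absolute_value A -> (0 < d)%N -> x ^+ d = y -> local_mahler A x <= local_mahler A y.
Proof.
move=> absA d0 xy.
pose f (t : algC) := Num.max 1 (A t).
have f1 t : 1 <= f t by rewrite le_max lexx.
have f0 t : 0 <= f t by apply: le_trans (f1 t).
have fX t : f t ^+ d = f (t ^+ d).
  rewrite /f (absvX absA); have [t1|t1] := leP (A t) 1.
    by rewrite expr1n (max_idPl _) // exprn_ile1 // absv_ge0.
  by rewrite (max_idPr _) // exprn_ege1 // ltW.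
rewrite -(@ler_pXn2r _ d) ?nnegrE ?(le_trans ler01 (local_mahler_ge1 _ _)) //.
rewrite /local_mahler -!prodrXl.
rewrite (eq_bigr (fun r => f (r ^+ d))) => [|r _]; last by rewrite fX.
rewrite -(big_map (fun r => r ^+ d) xpredT f) -prodr_undup_exp_count.
set s := [seq r ^+ d | r <- conjs x].
apply: (@le_trans _ _ (\prod_(t <- undup s) f t ^+ d)).
  rewrite big_seq [leRHS]big_seq; apply: ler_prod => t _.
  rewrite exprn_ge0 //= ler_weXn2l // count_map -size_filter -ltnS.
  rewrite -(size_XnsubC t d0); apply: max_poly_roots.
  - by rewrite -size_poly_eq0 size_XnsubC.
  - apply/allP => r; rewrite mem_filter /= => /andP[/eqP rt _].
    by rewrite rootE !hornerE rt subrr.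
  - by rewrite filter_uniq ?conjs_uniq.
apply: (@ler_prod_subset _ (fun t => f t ^+ d)); rewrite ?undup_uniq ?conjs_uniq //.
- move=> t; rewrite mem_undup => /mapP[r /conjs_autP[nu <-] ->].
  by rewrite -rmorphXn xy conjs_aut.
- by move=> t; rewrite exprn_ege1.
Qed.

End Comparison.

(** * Norms in a normal number field *)

Section Orbit.
Variables (L : splittingFieldType rat) (LC : {rmorphism L -> algC}).
Hypothesis galL : galois 1 {:L}.
Implicit Types (P : {group gal_of {:L}}) (y : L).

Definition gal_orbit P y : seq L := undup [seq g y | g : gal_of {:L} <- enum P].

Definition gal_stab P y : {set gal_of {:L}} := [set g in P | g y == y].

Lemma mem_gal_orbit P y z :
  reflect (exists2 g, g \in P & z = g y) (z \in gal_orbit P y).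
Proof.
rewrite mem_undup; apply: (iffP mapP) => -[g Pg ->]; exists g => //.
  by rewrite mem_enum in Pg.
by rewrite mem_enum.
Qed.

Lemma galM_full (g h : gal_of {:L}) y : (g * h)%g y = h (g y).
Proof. by rewrite galM ?memvf. Qed.

Lemma gal_stab_group_set P y : group_set (gal_stab P y).
Proof.
apply/group_setP; split=> [|g h]; first by rewrite inE group1 gal_id eqxx.
rewrite !inE => /andP[Pg /eqP gy] /andP[Ph /eqP hy].
by rewrite groupM //= galM_full gy hy eqxx.
Qed.

Canonical gal_stab_group P y := Group (gal_stab_group_set P y).

(** The elements of P sending y to [g y] form the right coset of the stabilizer through g, since the
    product of [gal_of] applies its left factor first. *)
Lemma count_gal_orbit P y z : z \in gal_orbit P y ->
  count_mem z [seq g y | g : gal_of {:L} <- enum P] = #|gal_stab P y|.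
Proof.
move=> /mem_gal_orbit[g Pg ->]; rewrite count_map -sum1_count big_enum_cond /=.
rewrite sum1dep_card -(card_rcoset (gal_stab P y) g); apply: eq_card => h.
rewrite mem_rcoset !inE galM_full groupMr ?groupV //; case: (h \in P) => //=.
have gK u : (g^-1)%g (g u) = u by rewrite -galM_full mulgV gal_id.
by apply/eqP/eqP => [->|{2}<-]; rewrite ?gK // -galM_full mulVg gal_id.
Qed.

Lemma prod_gal_orbit (S : comNzRingType) (f : L -> S) P y :
  \prod_(g in P) f (g y) = (\prod_(z <- gal_orbit P y) f z) ^+ #|gal_stab P y|.
Proof.
rewrite -big_enum -(big_map (fun g : gal_of {:L} => g y) xpredT f).
rewrite -prodr_undup_exp_count -prodrXl big_seq [RHS]big_seq.
by apply: eq_bigr => z zy; rewrite count_gal_orbit.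
Qed.

(** The preceding product formula with f constantly X, read off on degrees. *)
Lemma card_gal_orbit P y : #|P| = (size (gal_orbit P y) * #|gal_stab P y|)%N.
Proof.
have := prod_gal_orbit (fun=> 'X : {poly rat}) P y.
rewrite prodr_const big_const_seq count_predT iter_mulr_1 -exprM => /(congr1 (size \o polyseq)).
by rewrite /= !size_polyXn => -[].
Qed.

Lemma prod_gal_orbit_inv P y (g : gal_of {:L}) : g \in P ->
  forall (S : comNzRingType) (f : L -> S),
  \prod_(z <- gal_orbit P y) f (g z) = \prod_(z <- gal_orbit P y) f z.
Proof.
move=> Pg S f; rewrite -(big_map g xpredT f); apply: perm_big.
have uq : uniq (map g (gal_orbit P y)).
  by rewrite map_inj_uniq ?undup_uniq //; apply: fmorph_inj.
apply: uniq_perm => //; first exact: undup_uniq.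
apply: (uniq_min_size uq _ _).2; last by rewrite size_map.
move=> _ /mapP[z /mem_gal_orbit[h Ph ->] ->]; apply/mem_gal_orbit.
by exists (h * g)%g; rewrite ?groupM // galM_full.
Qed.

Lemma conjs_gal_orbit y :
  perm_eq (map LC (gal_orbit 'Gal({:L} / 1) y)) (conjs (LC y)).
Proof.
apply: uniq_perm; rewrite ?conjs_uniq //.
  by rewrite map_inj_uniq ?undup_uniq //; apply: fmorph_inj.
move=> r; rewrite mem_conjs -map_minPoly_minCpoly; apply/mapP/idP.
  move=> [z /mem_gal_orbit[g Gg ->] ->].
  by rewrite fmorph_root root_minPoly_gal ?sub1v ?memvf.
have /galois_factors := galL => /(_ (sub1v _) y (memvf y)) [s [sG _ ->]].
rewrite rmorph_prod /= (eq_bigr (fun z => 'X - (LC z)%:P)) => [|z _]; last first.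
  by rewrite map_polyXsubC.
rewrite -(big_map LC xpredT (fun z => 'X - z%:P)) root_prod_XsubC -map_comp.
move=> /mapP[g gs ->]; exists (g y) => //; apply/mem_gal_orbit; exists g => //.
by move/fintype.subsetP: sG; apply.
Qed.

Lemma local_mahler_gal (R : realType) (A : algC -> R) y :
  local_mahler A (LC y) =
  \prod_(z <- gal_orbit 'Gal({:L} / 1) y) Num.max 1 (A (LC z)).
Proof. by rewrite /local_mahler -(perm_big _ (conjs_gal_orbit y)) /= big_map. Qed.

Variable H : {group gal_of {:L}}.
Hypothesis nHG : normal H 'Gal({:L} / 1).
Local Notation G := ('Gal({:L} / 1)%G).

(** The norm of y from K(y) to K, where K is the fixed field of H; the orbit is listed without
    repetition. *)
Definition orbit_norm (y : L) : L := \prod_(z <- gal_orbit H y) z.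

Lemma orbit_norm_fixed y g : g \in H -> g (orbit_norm y) = orbit_norm y.
Proof. by move=> Hg; rewrite rmorph_prod (prod_gal_orbit_inv y Hg id). Qed.

(** The left side is the order of H Stab_G(y), and this whole product fixes the norm: H by
    construction, Stab_G(y) because it permutes the H-orbit of y. *)
Lemma orbit_norm_stab y :
  (size (gal_orbit H y) * #|gal_stab G y| <= #|gal_stab G (orbit_norm y)|)%N.
Proof.
have sHG := normal_sub nHG.
have -> : (size (gal_orbit H y) * #|gal_stab G y|)%N = #|(H * gal_stab G y)%g|.
  have := mul_cardG H (gal_stab_group G y); rewrite /= (card_gal_orbit H y).
  have -> : H :&: gal_stab G y = gal_stab H y.
    by apply/finset.setP => g; rewrite !inE; case Hg: (g \in H); rewrite ?(fintype.subsetP sHG g Hg).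
  rewrite mulnAC => /eqP; rewrite eqn_pmul2r ?(cardG_gt0 (gal_stab_group H y)) // => /eqP.
  by [].
apply/subset_leq_card/fintype.subsetP => k /mulsgP[h s Hh]; rewrite !inE => /andP[Gs /eqP sy] {k}->.
rewrite groupM ?(fintype.subsetP sHG h Hh) //= galM_full orbit_norm_fixed //.
apply/eqP; rewrite rmorph_prod -(big_map s xpredT id); apply: perm_big.
have uq : uniq (map s (gal_orbit H y)).
  by rewrite map_inj_uniq ?undup_uniq //; apply: fmorph_inj.
apply: uniq_perm => //; first exact: undup_uniq.
apply: (uniq_min_size uq _ _).2; last by rewrite size_map.
move=> _ /mapP[z /mem_gal_orbit[k Hk ->] ->]; apply/mem_gal_orbit.
(* Normality of H enters here: s (k y) = (k ^ s) (s y) = (k ^ s) y, and the conjugate [k ^ s] is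
   again in H. *)
exists (k ^ s)%g; first by rewrite memJ_norm // (fintype.subsetP (normal_norm nHG)).
by rewrite -galM_full conjgC galM_full sy.
Qed.

(** Both sides are turned into products over all of G. The norm is bounded by the product over the
    H-orbit, each member of which contributes as much as y after a translation of G. The exponents
    |Stab_G(y)| d and |Stab_G(b)| are compared by [orbit_norm_stab], the base being at least 1. *)
Lemma orbit_norm_local_mahler (R : realType) (A : algC -> R) y : absolute_value A ->
  local_mahler A (LC (orbit_norm y)) <= local_mahler A (LC y).
Proof.
move=> absA; set b := orbit_norm y; set d := size (gal_orbit H y).
pose f z := Num.max 1 (A (LC z)).
have f1 z : 1 <= f z by rewrite le_max lexx.
have Mf z : \prod_(g in G) f (g z) = local_mahler A (LC z) ^+ #|gal_stab G z|.
  by rewrite prod_gal_orbit local_mahler_gal.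
have st0 : (0 < #|gal_stab G b|)%N by exact: (cardG_gt0 (gal_stab_group G b)).
have M0 z : 0 <= local_mahler A (LC z) by apply: le_trans (local_mahler_ge1 _ _).
rewrite -(@ler_pXn2r _ #|gal_stab G b|) ?nnegrE // -Mf.
apply: (@le_trans _ _ (local_mahler A (LC y) ^+ (#|gal_stab G y| * d))); last first.
  by rewrite ler_weXn2l ?local_mahler_ge1 // mulnC orbit_norm_stab.
apply: (@le_trans _ _ (\prod_(g in G) \prod_(z <- gal_orbit H y) f (g z))).
  apply: ler_prod => g _; rewrite (le_trans ler01) //=.
  rewrite /f /b /orbit_norm !rmorph_prod /=.
  rewrite -(big_map (fun z => LC (g z)) xpredT id).
  by apply: le_trans (max1_prod _ absA) _; rewrite big_map.
rewrite exchange_big /= exprM -Mf.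
have e z : z \in gal_orbit H y -> \prod_(g in G) f (g z) = \prod_(g in G) f (g y).
  move=> /mem_gal_orbit[h Hh ->]; rewrite (reindex_inj (mulgI h^-1)%g) /=.
  apply: eq_big => g; first by rewrite groupMl // groupV (fintype.subsetP (normal_sub nHG)).
  by move=> _; rewrite -galM_full mulKVg.
by rewrite (eq_big_seq _ e) big_const_seq count_predT iter_mulr_1.
Qed.

End Orbit.

(** * The Galois closure *)

Section NormalSubfield.
Variables (K : {pred algC}) (nK : normal_subfield K).

Lemma nsub1 : 1 \in K. Proof. by have [[]] := nK. Qed.
Lemma nsubB x y : x \in K -> y \in K -> x - y \in K.
Proof. by have [[_ h _] _] := nK; apply: h. Qed.
Lemma nsub_div x y : x \in K -> y \in K -> x / y \in K.
Proof. by have [[_ _ h] _] := nK; apply: h. Qed.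
Lemma nsub0 : 0 \in K. Proof. by rewrite -(subrr 1) nsubB ?nsub1. Qed.
Lemma nsubN x : x \in K -> - x \in K. Proof. by move=> Kx; rewrite -sub0r nsubB ?nsub0. Qed.
Lemma nsubD x y : x \in K -> y \in K -> x + y \in K.
Proof. by move=> Kx Ky; rewrite -[y]opprK nsubB ?nsubN. Qed.
Lemma nsubM x y : x \in K -> y \in K -> x * y \in K.
Proof. by move=> Kx Ky; rewrite -[y]invrK nsub_div // -[y^-1]mul1r nsub_div ?nsub1. Qed.
Lemma nsub_nat n : n%:R \in K.
Proof. by elim: n => [|n IH]; rewrite ?nsub0 // -natr1 nsubD ?nsub1. Qed.
Lemma nsub_rat q : ratr q \in K.
Proof.
have nsub_int (n : int) : n%:~R \in K.
  by case: n => n; rewrite ?NegzE ?mulrNz ?nsubN ?[_%:~R]nsub_nat //; apply: nsub_nat.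
by rewrite nsub_div.
Qed.
Lemma nsub_conj x r : x \in K -> r \in conjs x -> r \in K.
Proof. by have [_ h] := nK; move=> Kx; rewrite mem_conjs; apply: h. Qed.

Lemma nsub_adjoin (L : fieldExtType rat) (LC : {rmorphism L -> algC}) (s : seq L) :
  (forall y, y \in s -> LC y \in K) -> forall z, z \in <<1 & s>>%VS -> LC z \in K.
Proof.
elim/last_ind: s => [|s x IH] h z.
  by rewrite (Fadjoin_nil 1%AS) => /vlineP[q ->]; rewrite alg_num_field fmorph_rat nsub_rat.
rewrite adjoin_rcons => /Fadjoin_polyP[p /polyOverP ps ->].
have Kx : LC x \in K by apply: h; rewrite mem_rcons mem_head.
have {}IH u : u \in <<1 & s>>%VS -> LC u \in K.
  by apply: IH => y ys; apply: h; rewrite mem_rcons inE ys orbT.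
rewrite -horner_map horner_coef; elim/big_ind: _ => [|a b|i _]; rewrite ?nsub0 //.
  exact: nsubD.
rewrite coef_map nsubM ?IH //=; elim: (nat_of_ord i) => [|k IHk]; first by rewrite nsub1.
by rewrite exprS nsubM.
Qed.

End NormalSubfield.

Section GaloisClosure.
Variable alpha : algC.

Lemma gclosureM x y : galois_closure alpha x -> galois_closure alpha y ->
  galois_closure alpha (x * y).
Proof. by move=> hx hy K nK Ka; apply: nsubM => //; [apply: hx|apply: hy]. Qed.

Lemma gclosureN x : galois_closure alpha x -> galois_closure alpha (- x).
Proof. by move=> hx K nK Ka; apply: nsubN => //; apply: hx. Qed.

Lemma gclosure_nat n : galois_closure alpha n%:R.
Proof. by move=> K nK Ka; apply: nsub_nat. Qed.

Lemma gclosure_conj x r : galois_closure alpha x -> r \in conjs x ->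
  galois_closure alpha r.
Proof. by move=> hx xr K nK Ka; apply: (nsub_conj nK (hx K nK Ka)). Qed.

(** The image of a normal number field containing alpha is one of the fields intersected in
    [galois_closure], so its degree bounds the degrees of all elements. *)
Lemma gclosure_degree : exists D, forall x, galois_closure alpha x ->
  (size (conjs x) <= D)%N.
Proof.
have [L [LC [s1 [galL sub]]]] := normal_num_field_exists [:: alpha].
exists (\dim {:L}) => x hx.
pose K : {pred algC} := [pred y | `[< exists z, y = LC z >]].
have KP y : reflect (exists z, y = LC z) (y \in K) by apply: asboolP.
have nK : normal_subfield K.
  split; first split.
  - by apply/KP; exists 1; rewrite rmorph1.
  - by move=> _ _ /KP[a ->] /KP[b ->]; apply/KP; exists (a - b); rewrite rmorphB.
  - by move=> _ _ /KP[a ->] /KP[b ->]; apply/KP; exists (a / b); rewrite fmorph_div.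
  - move=> _ r /KP[z ->]; rewrite -mem_conjs -(perm_mem (conjs_gal_orbit LC galL z)).
    by move=> /mapP[y _ ->]; apply/KP; exists y.
have /(hx K nK)/KP[z ->] : alpha \in K.
  have /mapP[y _ ->] : alpha \in map LC s1 by rewrite sub ?mem_head.
  by apply/KP; exists y.
rewrite -ltnS -size_conjs -map_minPoly_minCpoly size_map_poly size_minPoly ltnS.
by have := dim_Fadjoin 1%AS z; rewrite dimv1 muln1 => <-; rewrite dimvS // subvf.
Qed.

(* b n is the product of the d n distinct conjugates of a n over K_alpha, and
   D = [L : K_alpha] for a normal number field L containing all the a n. *)
Lemma orbit_norm_factorization (N : nat) (a : 'I_N.+1 -> algC) :
  alpha = \prod_(n < N.+1) a n ->
  exists (b : 'I_N.+1 -> algC) (d : 'I_N.+1 -> nat) (D : nat),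
  [/\ (0 < D)%N, forall n, (0 < d n)%N /\ galois_closure alpha (b n),
    forall (R : realType) (A : algC -> R) n, absolute_value A ->
      local_mahler A (b n) <= local_mahler A (a n) &
    forall t : 'I_N.+1 -> algC, (forall n, t n ^+ d n = b n) ->
      (\prod_(n < N.+1) t n) ^+ D = alpha ^+ D].
Proof.
move=> Da.
have [L [LC [s1 [galL sub]]]] := normal_num_field_exists (alpha :: codom a).
have /mapP[al _ Dal] : alpha \in map LC s1 by rewrite sub ?mem_head.
have /choice[c Dc] n : exists y, a n = LC y.
  have /mapP[y _ ->] : a n \in map LC s1 by rewrite sub // inE codom_f orbT.
  by exists y.
have Dal' : al = \prod_n c n.
  apply: (fmorph_inj LC); rewrite -Dal rmorph_prod Da.
  by apply: eq_bigr => n _; rewrite Dc.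
have /galois_factors := galL => /(_ (sub1v _) al (memvf al)) [s [sG _ Dmin]].
set rs := [seq _ | _ <- _] in Dmin.
pose K := <<1 & rs>>%AS.
have alK : al \in K.
  by apply: seqv_sub_adjoin; rewrite -root_prod_XsubC -Dmin root_minPoly.
have nK : normalField 1 K.
  apply/splitting_normalField; first exact: sub1v.
  exists (minPoly 1 al); first exact: minPolyOver.
  by exists rs => //; rewrite Dmin eqpxx.
have sKL : (1 <= K <= {:L})%VS by rewrite sub1v subvf.
have galK : galois K {:L} by apply: galoisS galL; rewrite sub1v subvf.
pose H := 'Gal({:L} / K)%G.
have nHG : normal H 'Gal({:L} / 1) by apply: normalField_normal.
have KC z : z \in K -> galois_closure alpha (LC z).
  move=> zK E nE Ea; apply: (nsub_adjoin nE) zK => y /mapP[g gs ->].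
  apply: (nsub_conj nE Ea); rewrite Dal -(perm_mem (conjs_gal_orbit LC galL al)).
  apply/mapP; exists (g al) => //; apply/mem_gal_orbit; exists g => //.
  by move/fintype.subsetP: sG; apply.
exists (fun n => LC (orbit_norm H (c n))), (fun n => size (gal_orbit H (c n))), #|H|.
split.
- exact: cardG_gt0.
- move=> n; split.
    have := cardG_gt0 H; rewrite (card_gal_orbit H (c n)) muln_gt0.
    by case/andP.
  apply: KC; have /galois_fixedField <- := galK.
  by apply/fixedFieldP; rewrite ?memvf // => g Hg; apply: orbit_norm_fixed.
- by move=> R A n absA; rewrite Dc; apply: orbit_norm_local_mahler.
(* By orbit counting t_n^|H| is the product of g (a_n) over all g in H; exchanging the products
   leaves g (alpha) = alpha for each g. *)
- move=> t ht; rewrite -prodrXl.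
  rewrite (eq_bigr (fun n => \prod_(g in H) LC (g (c n)))) => [|n _]; last first.
    rewrite {1}(card_gal_orbit H (c n)) exprM ht -rmorphXn -rmorph_prod; congr (LC _).
    by rewrite (prod_gal_orbit id).
  rewrite exchange_big /= (eq_bigr (fun=> alpha)) ?prodr_const // => g Hg.
  rewrite -rmorph_prod -rmorph_prod -Dal' Dal; congr (LC _).
  exact: (fixed_gal (subvf K) Hg).
Qed.

End GaloisClosure.

(** * Attaining the infimum *)

(** Descent on the number of entries of [s] below the current candidate. *)
Lemma exists_min_locally_finite (R : realType) (P : R -> Prop) (s : seq R) (m0 : R) :
  P m0 -> (forall m, P m -> m <= m0 -> m \in s) ->
  exists2 m, P m & forall m', P m' -> m <= m'.
Proof.
have [k] := ubnP (count (fun m => m < m0) s); elim: k m0 => // k IH m0 cs Pm0 hs.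
have [[m [Pm lt]]|nex] := pselect (exists m, P m /\ m < m0); last first.
  by exists m0 => // m' Pm'; rewrite leNgt; apply/negP => lt; apply: nex; exists m'.
apply: (IH m) => // [|m' Pm' le]; last by apply: hs => //; apply: le_trans le (ltW lt).
apply: leq_trans (_ : (count (fun m => m < m0)%R s <= k)%N); last by rewrite -ltnS.
have ms : m \in s by apply: hs => //; apply: ltW.
rewrite (seq.permP (perm_to_rem ms)) [leqRHS](seq.permP (perm_to_rem ms)) /= ltxx lt add0n add1n ltnS.
by apply: sub_count => x /= /lt_trans; apply.
Qed.

(** * Northcott finiteness for values of the Mahler measure *)

Section Northcott.
Variables (R : realType) (iota : {rmorphism algC -> R[i]}).

Lemma mahler_ge1 x : 1 <= mahler R x.
Proof.
rewrite (mahler_formula iota) mulr_ege1 ?local_mahler_ge1 // ler1n.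
by have [] := int_minpolyP x.
Qed.

(** A factor X - r adds two shifted copies, each at most max(1, |r|) times the old bound; hence one
    factor 2 per root. *)
Lemma coef_bound (A : algC -> R) (s : seq algC) : absolute_value A ->
  forall i, A (\prod_(r <- s) ('X - r%:P))`_i <=
    2 ^+ size s * \prod_(r <- s) Num.max 1 (A r).
Proof.
move=> absA; elim: s => [|r s IH] i.
  rewrite !big_nil expr0 mul1r coef1; case: (i == 0%N); rewrite ?absv1 ?absv0 //.
rewrite !big_cons mulrBl coefB coefXM coefCM exprS.
set B := 2 ^+ _ * _ in IH; set c := \prod_(j <- s) _ in IH *.
have B0 : 0 <= B by apply: le_trans (IH 0%N); apply: absv_ge0.
have m1 : 1 <= Num.max 1 (A r) by rewrite le_max lexx.
have mr : A r <= Num.max 1 (A r) by rewrite le_max lexx orbT.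
apply: le_trans (absvB absA _ _) _.
have -> : 2 * 2 ^+ size s * (Num.max 1 (A r) * \prod_(j <- s) Num.max 1 (A j)) =
  Num.max 1 (A r) * B + Num.max 1 (A r) * B by rewrite /B; ring.
apply: lerD.
  apply: (@le_trans _ _ B); last by rewrite ler_peMl.
  by case: ifP => _; rewrite ?absv0.
by rewrite (absvM absA) ler_pM ?absv_ge0.
Qed.

(** The Mahler measure as a function of an integral polynomial alone. The roots are extracted after
    making the polynomial monic, so that for [int_minpoly x] they are exactly [conjs x]. *)
Definition int_mahler (q : {poly int}) : R :=
  `|lead_coef q|%N%:R * \prod_(r <- sval (closed_field_poly_normal
      ((`|lead_coef q|%N%:R : algC)^-1 *: map_poly intr q))) Num.max 1 (arch_abs iota r).

Lemma mahler_int x : mahler R x = int_mahler (int_minpoly x).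
Proof.
have [l0 _ e] := int_minpolyP x; rewrite (mahler_formula iota) /int_mahler e.
rewrite -/(minpoly_lead x) scalerA mulVf ?scale1r //.
by rewrite pnatr_eq0 -lt0n.
Qed.

Lemma int_minpoly_coef x i :
  `|((int_minpoly x)`_i)%R|%N%:R <= 2 ^+ size (conjs x) * mahler R x.
Proof.
have absA : absolute_value (arch_abs iota) by apply: normc_absolute_value.
have [l0 _ e] := int_minpolyP x.
have Anat n : arch_abs iota n%:R = n%:R.
  by rewrite -(ratr_nat algC) [LHS]normc_rat /= ratr_nat ger0_norm.
have Aint (n : int) : arch_abs iota n%:~R = `|n|%N%:R.
  by case: n => n; rewrite ?NegzE ?mulrNz ?(absvN absA) [LHS]Anat.
have := congr1 (fun q : {poly algC} => arch_abs iota q`_i) e.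
rewrite coef_map coefZ (absvM absA) Anat /= Aint => ->.
rewrite (mahler_formula iota) mulrCA ler_wpM2l // minCpolyE.
exact: coef_bound.
Qed.

Lemma mahler_northcott (D : nat) (C : R) : exists s : seq R, forall x,
  (size (conjs x) <= D)%N -> mahler R x <= C -> mahler R x \in s.
Proof.
have [N hN] : exists N : nat, 2 ^+ D * C <= N%:R.
  exists (Num.bound `|2 ^+ D * C|); rewrite (le_trans (ler_norm _)) // ltW //.
  exact: archi_boundP.
(* Coefficients between -N and N, shifted by N to become ordinals; D + 1 of them suffice for degree
   at most D. *)
pose T := {ffun 'I_D.+1 -> 'I_(N + N).+1}.
pose Q (f : T) : {poly int} := \poly_(i < D.+1) ((f (inord i))%:Z - N%:Z).
exists [seq int_mahler (Q f) | f <- enum T] => x sx Mx.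
pose q := int_minpoly x.
have qN i : (`|(q`_i)%R| <= N)%N.
  rewrite -(ler_nat R); apply: le_trans (int_minpoly_coef x i) _; apply: le_trans hN.
  apply: ler_pM => //; first by rewrite (le_trans ler01) ?mahler_ge1.
  by rewrite ler_weXn2l ?ler1n.
have szq : (size q <= D.+1)%N.
  have [l0 _ e] := int_minpolyP x.
  have : size (map_poly intr q : {poly algC}) = size q by rewrite size_map_inj_poly //; apply: intr_inj.
  rewrite e size_scale ?pnatr_eq0 -?lt0n // size_conjs => <-; by rewrite ltnS.
rewrite mahler_int; apply/mapP.
exists [ffun i : 'I_D.+1 => inord `|(q`_i + N%:Z)%R|%N]; first by rewrite mem_enum.
congr int_mahler; apply/polyP => i; rewrite coef_poly.
case: ltnP => [iD|Di]; last by rewrite nth_default // (leq_trans szq).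
have qi := qN i; rewrite ffunE !inordK //.
  rewrite gez0_abs; first by rewrite addrK.
  by move: qi; move: (q`_i) => z; lia.
by move: qi; move: (q`_i) => z; lia.
Qed.

End Northcott.

(** * Factorizations against radical values *)

Section Ultrametric.
Variables (R : realType) (iota : {rmorphism algC -> R[i]}) (alpha : algC).
Hypothesis alpha_neq0 : alpha != 0.

Definition max_mahler (N : nat) (a : 'I_N.+1 -> algC) : R :=
  \big[Num.max/mahler R (a ord0)]_(n < N.+1) mahler R (a n).

Definition factorization_value (m : R) : Prop :=
  exists (N : nat) (a : 'I_N.+1 -> algC),
    [/\ forall n, a n != 0, alpha = \prod_(n < N.+1) a n & m = max_mahler a].

(* The equality of D-th powers expresses equality up to a root of unity. *)
Definition radical_value (m : R) : Prop :=
  exists (N : nat) (b t : 'I_N.+1 -> algC) (d : 'I_N.+1 -> nat) (D : nat),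
    [/\ (0 < D)%N, forall n, (0 < d n)%N /\ galois_closure alpha (b n),
        forall n, t n ^+ d n = b n,
        (\prod_(n < N.+1) t n) ^+ D = alpha ^+ D & m = max_mahler b].

Lemma max_mahler_ge N (a : 'I_N.+1 -> algC) n : mahler R (a n) <= max_mahler a.
Proof. exact: le_bigmax. Qed.

Lemma max_mahler_le N (a : 'I_N.+1 -> algC) m :
  (forall n, mahler R (a n) <= m) -> max_mahler a <= m.
Proof. by move=> h; apply: bigmax_le. Qed.

Lemma max_mahler_eq N (a : 'I_N.+1 -> algC) :
  exists n, max_mahler a = mahler R (a n).
Proof.
rewrite /max_mahler; elim/big_ind: _ => [|x y [i ->] [j ->]|i _]; first by exists ord0.
  by case: (leP (mahler R (a i)) (mahler R (a j))) => _; [exists j | exists i].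
by exists i.
Qed.

Lemma radical_of_factorization m : factorization_value m ->
  exists2 m', radical_value m' & m' <= m.
Proof.
move=> [N [a [a0 Da ->]]].
have [b [d [D [D0 hb le_ba hD]]]] := orbit_norm_factorization Da.
have /choice[t ht] n : exists y, y ^+ d n = b n.
  exists ((d n).-root (b n)); rewrite rootCK //; exact: (hb n).1.
exists (max_mahler b).
  by exists N, b, t, d, D; split=> //; apply: hD.
apply: max_mahler_le => n; apply: le_trans (max_mahler_ge a n).
by apply: (mahler_le iota) => A absA; apply: le_ba.
Qed.

(** The roots t_n multiply to T, and z = alpha / T satisfies z^D = 1. Adding z as one more factor
    yields a genuine factorization, and its maximum does not grow because z is a root of 1. *)
Lemma factorization_of_radical m : radical_value m ->
  exists2 m', factorization_value m' & m' <= m.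
Proof.
move=> [N [b [t [d [D [D0 hb ht hD ->]]]]]].
pose T := \prod_(n < N.+1) t n.
have T0 : T != 0.
  apply: contraNneq alpha_neq0 => T0; move/eqP: hD.
  by rewrite -/T T0 expr0n eqn0Ngt D0 eq_sym expf_eq0 D0.
pose z := alpha / T.
(* Indices up to N carry the roots t_n; the last index N + 1 carries the root of unity z. *)
pose a (i : 'I_N.+2) := if insub (val i) is Some j then t j else z.
have aw (j : 'I_N.+1) : a (widen_ord (leqnSn N.+1) j) = t j by rewrite /a /= valK.
have am : a ord_max = z by rewrite /a /= insubF // ltnn.
have Da : alpha = \prod_(i < N.+2) a i.
  rewrite big_ord_recr /= am (eq_bigr t) => [|j _]; last exact: aw.
  by rewrite mulrC divfK.
exists (max_mahler a).
  exists N.+1, a; split=> // n; apply: contraNneq alpha_neq0 => an0.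
  by rewrite Da (bigD1 n) //= an0 mul0r.
apply: max_mahler_le => i; rewrite /a; case: insubP => [j _ _|_].
  apply: le_trans (max_mahler_ge b j).
  apply: (mahler_le iota) => A absA.
  exact: local_mahler_root absA (hb j).1 (ht j).
apply: (@le_trans _ _ (mahler R (b ord0))); last exact: max_mahler_ge.
apply: (mahler_le iota) => A absA.
apply: (@le_trans _ _ (local_mahler A 1)).
  apply: local_mahler_root absA D0 _.
  by rewrite /z expr_div_n hD divff // expf_neq0.
by rewrite local_mahler1 // local_mahler_ge1.
Qed.

Lemma radical_value_mahler m : radical_value m ->
  exists2 beta, galois_closure alpha beta & m = mahler R beta.
Proof.
move=> [N [b [t [d [D [D0 hb ht hD ->]]]]]].
by have [n ->] := max_mahler_eq b; exists (b n) => //; exact: (hb n).2.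
Qed.

(** The minimum m over radical values exists by local finiteness. It bounds all factorization values
    from below and dominates one of them, so it is their infimum. *)
Lemma ultrametric_mahler_attained :
  exists2 beta, galois_closure alpha beta & ultrametric_mahler R alpha = mahler R beta.
Proof.
have fa : factorization_value (mahler R alpha).
  exists 0%N, (fun=> alpha); rewrite big_ord1; split=> //.
  by rewrite /max_mahler big_ord_recl big_ord0 maxxx.
have [m0 rm0 _] := radical_of_factorization fa.
have [D hDeg] := gclosure_degree alpha.
have [s hs] := mahler_northcott iota D m0.
have [|m rm minm] := @exists_min_locally_finite R radical_value s m0 rm0.
  by move=> m /radical_value_mahler[beta gb ->] /hs; apply; apply: hDeg.
have [beta gb Dm] := radical_value_mahler rm; exists beta => //; rewrite -Dm.
rewrite /ultrametric_mahler.
set S := mkset _.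
have Sfact y : S y <-> factorization_value y by [].
have lbS : lbound S m.
  move=> y /Sfact /radical_of_factorization[m' /minm le1 le2].
  exact: le_trans le2.
apply: le_anti; apply/andP; split; last first.
  by apply: lb_le_inf => //; exists (mahler R alpha); apply/Sfact.
have [m' fm' le'] := factorization_of_radical rm.
apply: le_trans le'; apply: ge_inf; last exact/Sfact.
by exists m.
Qed.

End Ultrametric.

(** * The Mahler measure as an element of the Galois closure *)

Section RealValue.
Variables (R : realType) (iota : {rmorphism algC -> R[i]}).

(** Let y be the product of the conjugates of modulus above 1. Complex conjugation permutes these
    conjugates, so [iota y] is real and its modulus is y or -y. *)
Lemma mahler_gclosure alpha beta : galois_closure alpha beta ->
  exists2 gamma, galois_closure alpha gamma & iota gamma = (mahler R beta)%:C%C.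
Proof.
move=> gb; pose big (r : algC) := 1 < Normc.normc (iota r).
pose y := \prod_(r <- conjs beta | big r) r.
have gy : galois_closure alpha y.
  move=> K nK Ka; rewrite /y big_seq_cond; elim/big_ind: _ => [|u w|r].
  - exact: nsub1.
  - exact: nsubM.
  - by move=> /andP[rb _]; apply: (gclosure_conj gb rb).
have absN := normc_absolute_value iota.
have normJ (u : R[i]) : Normc.normc (u^*)%C = Normc.normc u.
  by case: u => a b /=; rewrite sqrrN.
have My : mahler R beta = (minpoly_lead beta)%:R * Normc.normc (iota y).
  rewrite (mahler_formula iota); congr (_ * _).
  have -> : Normc.normc (iota y) = \prod_(r <- conjs beta | big r) Normc.normc (iota r).
    exact: (absv_prod absN).
  rewrite /local_mahler [RHS]big_mkcond /=; apply: eq_bigr => r _.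
  by rewrite /big /arch_abs; case: ltP.
(* Conjugation is taken in [R[i]], [iota] being an arbitrary embedding; it permutes the images
   because they are the roots of a rational polynomial. *)
have perm : perm_eq [seq (iota r)^*%C | r <- conjs beta] (map iota (conjs beta)).
  have inj : injective (fun r => (iota r)^*%C).
    by move=> r1 r2 /(congr1 (@conjc R)); rewrite !conjcK => /fmorph_inj.
  have uq : uniq [seq (iota r)^*%C | r <- conjs beta].
    by rewrite map_inj_uniq ?conjs_uniq.
  apply: uniq_perm => //; first by rewrite map_inj_uniq ?conjs_uniq //; apply: fmorph_inj.
  apply: (uniq_min_size uq _ _).2; last by rewrite !size_map.
  move=> _ /mapP[r rb ->]; have [q Dq] := minCpoly_rat beta.
  have Di : map_poly ratr q = \prod_(u <- map iota (conjs beta)) ('X - u%:P) :> {poly R[i]}.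
    rewrite -(eq_map_poly (fmorph_rat iota)) (map_poly_comp iota) -Dq minCpolyE.
    rewrite rmorph_prod big_map; apply: eq_bigr => s _; exact: map_polyXsubC.
  rewrite -root_prod_XsubC -Di -(eq_map_poly (fmorph_rat (@conjc R))) map_poly_comp.
  by rewrite fmorph_root Di root_prod_XsubC map_f.
have yJ : (iota y)^*%C = iota y.
  rewrite /y !rmorph_prod.
  have -> : \prod_(r <- conjs beta | big r) iota r =
      \prod_(u <- map iota (conjs beta) | 1 < Normc.normc u) u by rewrite big_map.
  rewrite -(perm_big _ perm) big_map; apply: eq_bigl => r.
  by rewrite normJ.
have [c Dc] : exists c : R, iota y = c%:C%C.
  move: yJ; case: (iota y) => c e /= [ee]; exists c; congr (_ +i* _)%C.
  by apply/eqP; move/eqP: ee; rewrite eq_sym -subr_eq0 opprK -mulr2n mulrn_eq0.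
have nc : Normc.normc (iota y) = `|c| by rewrite Dc /= expr0n addr0 sqrtr_sqr.
pose l : algC := (minpoly_lead beta)%:R.
have gl : galois_closure alpha (l * y) by apply: gclosureM gy; apply: gclosure_nat.
have il : iota (l * y) = ((minpoly_lead beta)%:R * c)%:C%C.
  by rewrite rmorphM rmorph_nat Dc [RHS]rmorphM rmorph_nat.
rewrite My nc; have [c0|c0] := leP 0 c.
  by exists (l * y) => //; rewrite il ger0_norm.
exists (- (l * y)); first exact: gclosureN.
rewrite rmorphN il ltr0_norm // mulrN.
by apply/eqP; rewrite eq_complex /= oppr0 !eqxx.
Qed.

End RealValue.

Local Open Scope complex_scope.

(* iota is the fixed embedding of the algebraic numbers into C = R[i]. *)
Theorem theorem4p1 (R : realType) (iota : {rmorphism algC -> R[i]})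
    (alpha : algC) (alpha_neq0 : alpha != 0) :
  (exists beta : algC,
     galois_closure alpha beta /\ ultrametric_mahler R alpha = mahler R beta) /\
  (exists gamma : algC,
     galois_closure alpha gamma /\ iota gamma = (ultrametric_mahler R alpha)%:C).
Proof.
have [beta gb Mb] := ultrametric_mahler_attained iota alpha_neq0.
split; first by exists beta.
by have [gamma gg ig] := mahler_gclosure iota gb; exists gamma; rewrite Mb.
Qed.
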